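(* Let $E$ be a row-finite graph, $K$ a field and $L(E)=L_K(E)$ the Leavitt path algebra. The following conditions are equivalent. (i) $L(E)$ is left primitive. (ii) $L(E)$ is right primitive. (iii) $E$ satisfies Condition (L) (every cycle in $E$ has an exit) and Condition (MT3) (for every $v,w\in E^0$ there exists $y\in E^0$ such that $v\ge y$ and $w\ge y$). (iv) $I\cap J\cap E^0\neq\emptyset$ for all nonzero ideals $I$ and $J$ of $L(E)$.
   Context: A (directed) graph $E=(E^0,E^1,r,s)$ consists of countable (finite or countably infinite) sets $E^0$ (vertices), $E^1$ (edges) and maps $r,s:E^1\to E^0$ (range, source). It is row-finite if $s^{-1}(v)$ is finite for every $v\in E^0$; all graphs are row-finite. A path is either a vertex $v$ (length $0$, with source and range $v$) or a sequence $\mu=e_1\dots e_n$ of edges with $r(e_i)=s(e_{i+1})$; $s(\mu)=s(e_1)$, $r(\mu)=r(e_n)$. The Leavitt path algebra $L_K(E)$ is the (associative, not necessarily unital) $K$-algebra generated by pairwise orthogonal idempotents $\{v\mid v\in E^0\}$ and elements $\{e,e^*\mid e\in E^1\}$ subject to: $s(e)e=er(e)=e$; $r(e)e^*=e^*s(e)=e^*$; $e^*e'=\delta_{e,e'}r(e)$ for $e,e'\in E^1$; $v=\sum_{\{e\in E^1\mid s(e)=v\}}ee^*$ for every $v\in E^0$ that emits edges. Write $v\ge w$ if there is a path with source $v$ and range $w$. A cycle is a path $e_1\dots e_n$ ($n\ge1$) with $s(e_1)=r(e_n)$ and $s(e_i)\ne s(e_j)$ for $i\ne j$. An edge $e$ is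 an exit for a path $e_1\dots e_n$ if there is $i$ with $s(e)=s(e_i)$ and $e\neq e_i$. Ideals are two-sided. A ring $R$ is right (resp. left) primitive if it has a simple and faithful right (resp. left) $R$-module. *)

(* Defs.v *)
From HB Require Import structures.
From mathcomp Require Import all_boot all_algebra.
From mathcomp Require Import boolp classical_sets cardinality.

Set Implicit Arguments.
Unset Strict Implicit.
Unset Printing Implicit Defensive.

Import GRing.Theory.
Local Open Scope classical_set_scope.
Local Open Scope ring_scope.
Local Open Scope quotient_scope.

(** * Associative, not necessarily unital, rings and algebras *)

Reserved Notation "x ** y" (at level 40, left associativity).

HB.mixin Record Zmodule_isNonUnitalRing R of GRing.Zmodule R := {
  rng_mul : R -> R -> R;
  rng_mulA : associative rng_mul;
  rng_mulDl : left_distributive rng_mul +%R;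
  rng_mulDr : right_distributive rng_mul +%R
}.

#[short(type="rngType")]
HB.structure Definition NonUnitalRing :=
  { R of Zmodule_isNonUnitalRing R & GRing.Zmodule R }.

Notation "x ** y" := (rng_mul x y) : ring_scope.

HB.mixin Record Lmodule_isNonUnitalAlgebra (K : fieldType) A
    of GRing.Lmodule K A & NonUnitalRing A := {
  rng_scalerAl : forall (k : K) (x y : A), k *: (x ** y) = (k *: x) ** y;
  rng_scalerAr : forall (k : K) (x y : A), k *: (x ** y) = x ** (k *: y)
}.

#[short(type="nonUnitalAlgType")]
HB.structure Definition NonUnitalAlgebra (K : fieldType) :=
  { A of Lmodule_isNonUnitalAlgebra K A & GRing.Lmodule K A & NonUnitalRing A }.

(** * Two-sided ideals, modules, primitivity *)

Definition subgroup (M : zmodType) (N : set M) : Prop :=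
  N 0 /\ forall x y, N x -> N y -> N (x - y).

Definition two_sided_ideal (R : rngType) (I : set R) : Prop :=
  subgroup I /\ forall r x, I x -> I (r ** x) /\ I (x ** r).

Definition left_module (R : rngType) (M : zmodType) (act : R -> M -> M) : Prop :=
  [/\ forall r m n, act r (m + n) = act r m + act r n,
      forall r s m, act (r + s) m = act r m + act s m
    & forall r s m, act (r ** s) m = act r (act s m)].

Definition right_module (R : rngType) (M : zmodType) (act : M -> R -> M) : Prop :=
  [/\ forall r m n, act (m + n) r = act m r + act n r,
      forall r s m, act m (r + s) = act m r + act m s
    & forall r s m, act m (r ** s) = act (act m r) s].

(* In the next two definitions [act r m] is the action of [r] on [m], for a
   module on either side.  Simplicity does not separately require R M <> 0:
   for R <> 0 this follows from faithfulness, so it only makes a difference in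
   the notion of primitivity for the zero ring, which is primitive here. *)
Definition simple_module (R : rngType) (M : zmodType) (act : R -> M -> M) : Prop :=
  (exists m : M, m <> 0) /\
  forall N : set M, subgroup N -> (forall r m, N m -> N (act r m)) ->
    N = [set 0] \/ N = setT.

Definition faithful_module (R : rngType) (M : zmodType) (act : R -> M -> M) : Prop :=
  forall r, (forall m, act r m = 0) -> r = 0.

Definition left_primitive (R : rngType) : Prop :=
  exists (M : zmodType) (act : R -> M -> M),
    [/\ left_module act, simple_module act & faithful_module act].

Definition right_primitive (R : rngType) : Prop :=
  exists (M : zmodType) (act : M -> R -> M),
    [/\ right_module act,
        simple_module (fun r m => act m r)
      & faithful_module (fun r m => act m r)].

(** * Graphs *)

Record graph := Graph {
  vertex : countType;
  edge : countType;
  src : edge -> vertex;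
  rng : edge -> vertex
}.

Arguments src {g}.
Arguments rng {g}.

Definition row_finite (E : graph) : Prop :=
  forall v : vertex E, finite_set [set e : edge E | src e = v].

(* [is_path v p w]: the edge sequence [p] is a path with source [v] and range
   [w]; the empty sequence stands for the path of length 0 at [v] = [w]. *)
Fixpoint is_path (E : graph) (v : vertex E) (p : seq (edge E)) (w : vertex E)
    : Prop :=
  if p is e :: q then src e = v /\ is_path (rng e) q w else v = w.

Definition reaches (E : graph) (v w : vertex E) : Prop :=
  exists p, is_path v p w.

Definition is_cycle (E : graph) (p : seq (edge E)) : Prop :=
  [/\ p <> [::], exists v, is_path v p v & uniq (map src p)].

Definition is_exit (E : graph) (p : seq (edge E)) (e : edge E) : Prop :=
  exists f, [/\ f \in p, src e = src f & e <> f].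

Definition condition_L (E : graph) : Prop :=
  forall p : seq (edge E), is_cycle p -> exists e, is_exit p e.

Definition condition_MT3 (E : graph) : Prop :=
  forall v w : vertex E, exists y, reaches v y /\ reaches w y.

(** * The Leavitt path algebra, by generators and relations *)

Section Leavitt.
Variables (K : fieldType) (E : graph).

Inductive lterm : Type :=
  | TVertex of vertex E
  | TEdge of edge E
  | TGhost of edge E
  | TZero
  | TAdd of lterm & lterm
  | TOpp of lterm
  | TScale of K & lterm
  | TMul of lterm & lterm.

(* The smallest congruence on terms that contains the axioms of associative
   K-algebras and the defining relations of L_K(E). *)
Inductive lcong : lterm -> lterm -> Prop :=
  | LRefl a : lcong a a
  | LSym a b : lcong a b -> lcong b a
  | LTrans a b c : lcong a b -> lcong b c -> lcong a c
  | LCongAdd a a' b b' :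
      lcong a a' -> lcong b b' -> lcong (TAdd a b) (TAdd a' b')
  | LCongOpp a a' : lcong a a' -> lcong (TOpp a) (TOpp a')
  | LCongScale k a a' : lcong a a' -> lcong (TScale k a) (TScale k a')
  | LCongMul a a' b b' :
      lcong a a' -> lcong b b' -> lcong (TMul a b) (TMul a' b')
  | LAddA a b c : lcong (TAdd a (TAdd b c)) (TAdd (TAdd a b) c)
  | LAddC a b : lcong (TAdd a b) (TAdd b a)
  | LAdd0 a : lcong (TAdd TZero a) a
  | LAddN a : lcong (TAdd (TOpp a) a) TZero
  | LScaleA k l a : lcong (TScale k (TScale l a)) (TScale (k * l) a)
  | LScale1 a : lcong (TScale 1 a) a
  | LScaleDr k a b :
      lcong (TScale k (TAdd a b)) (TAdd (TScale k a) (TScale k b))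
  | LScaleDl k l a :
      lcong (TScale (k + l) a) (TAdd (TScale k a) (TScale l a))
  | LMulA a b c : lcong (TMul a (TMul b c)) (TMul (TMul a b) c)
  | LMulDl a b c : lcong (TMul (TAdd a b) c) (TAdd (TMul a c) (TMul b c))
  | LMulDr a b c : lcong (TMul a (TAdd b c)) (TAdd (TMul a b) (TMul a c))
  | LScaleAl k a b : lcong (TScale k (TMul a b)) (TMul (TScale k a) b)
  | LScaleAr k a b : lcong (TScale k (TMul a b)) (TMul a (TScale k b))
  | LVertexIdem v : lcong (TMul (TVertex v) (TVertex v)) (TVertex v)
  | LVertexOrth v w : v <> w -> lcong (TMul (TVertex v) (TVertex w)) TZero
  | LSrcEdge e : lcong (TMul (TVertex (src e)) (TEdge e)) (TEdge e)
  | LEdgeRng e : lcong (TMul (TEdge e) (TVertex (rng e))) (TEdge e)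
  | LRngGhost e : lcong (TMul (TVertex (rng e)) (TGhost e)) (TGhost e)
  | LGhostSrc e : lcong (TMul (TGhost e) (TVertex (src e))) (TGhost e)
  | LGhostEdge e : lcong (TMul (TGhost e) (TEdge e)) (TVertex (rng e))
  | LGhostEdge0 e f : e <> f -> lcong (TMul (TGhost e) (TEdge f)) TZero
  (* [s] lists without repetition the (finitely many) edges emitted by [v] *)
  | LCuntzKrieger (v : vertex E) (s : seq (edge E)) :
      s <> [::] -> uniq s -> (forall e, e \in s <-> src e = v) ->
      lcong (TVertex v)
            (\big[TAdd/TZero]_(e <- s) TMul (TEdge e) (TGhost e)).

HB.instance Definition _ := gen_eqMixin lterm.
HB.instance Definition _ := gen_choiceMixin lterm.

Definition lcongb (a b : lterm) : bool := `[< lcong a b >].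

Fact lcongb_refl : reflexive lcongb.
Proof. by move=> a; apply/asboolP; exact: LRefl. Qed.

Fact lcongb_sym : symmetric lcongb.
Proof. by move=> a b; apply/asboolP/asboolP; exact: LSym. Qed.

Fact lcongb_trans : transitive lcongb.
Proof.
by move=> b a c /asboolP ab /asboolP bc; apply/asboolP; exact: LTrans ab bc.
Qed.

Canonical lcong_equiv := EquivRel lcongb lcongb_refl lcongb_sym lcongb_trans.

Definition leavitt : Type := {eq_quot lcongb}.

HB.instance Definition _ := Choice.on leavitt.
HB.instance Definition _ : EqQuotient _ lcongb leavitt := EqQuotient.on leavitt.

Lemma leavittP (a b : lterm) : \pi_leavitt a = \pi_leavitt b <-> lcong a b.
Proof. by split=> [/eqmodP/asboolP //|ab]; apply/eqmodP/asboolP. Qed.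

Let lc (x : leavitt) : lterm := repr x.
Let cl (a : lterm) : leavitt := \pi_leavitt a.

Let lcK a : lcong (lc (cl a)) a.
Proof. by apply/leavittP; rewrite /lc reprK. Qed.

Let clK x : cl (lc x) = x. Proof. exact: reprK. Qed.

Definition leavitt_add (x y : leavitt) : leavitt := cl (TAdd (lc x) (lc y)).
Definition leavitt_opp (x : leavitt) : leavitt := cl (TOpp (lc x)).
Definition leavitt_scale (k : K) (x : leavitt) : leavitt := cl (TScale k (lc x)).
Definition leavitt_mul (x y : leavitt) : leavitt := cl (TMul (lc x) (lc y)).

Lemma pi_leavitt_add a b : cl (TAdd a b) = leavitt_add (cl a) (cl b).
Proof. by apply/leavittP/LCongAdd; apply: LSym. Qed.

Lemma pi_leavitt_opp a : cl (TOpp a) = leavitt_opp (cl a).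
Proof. by apply/leavittP/LCongOpp; apply: LSym. Qed.

Lemma pi_leavitt_scale k a : cl (TScale k a) = leavitt_scale k (cl a).
Proof. by apply/leavittP/LCongScale; apply: LSym. Qed.

Lemma pi_leavitt_mul a b : cl (TMul a b) = leavitt_mul (cl a) (cl b).
Proof. by apply/leavittP/LCongMul; apply: LSym. Qed.

Let piE := (pi_leavitt_add, pi_leavitt_opp, pi_leavitt_scale, pi_leavitt_mul).

Fact leavitt_addA : associative leavitt_add.
Proof.
move=> x y z; rewrite -[x]clK -[y]clK -[z]clK -!piE.
by apply/leavittP; exact: LAddA.
Qed.

Fact leavitt_addC : commutative leavitt_add.
Proof.
by move=> x y; rewrite -[x]clK -[y]clK -!piE; apply/leavittP; exact: LAddC.
Qed.

Fact leavitt_add0 : left_id (cl TZero) leavitt_add.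
Proof. by move=> x; rewrite -[x]clK -!piE; apply/leavittP; exact: LAdd0. Qed.

Fact leavitt_addN : left_inverse (cl TZero) leavitt_opp leavitt_add.
Proof. by move=> x; rewrite -[x]clK -!piE; apply/leavittP; exact: LAddN. Qed.

HB.instance Definition _ := GRing.isZmodule.Build leavitt
  leavitt_addA leavitt_addC leavitt_add0 leavitt_addN.

Let addE (x y : leavitt) : x + y = leavitt_add x y. Proof. by []. Qed.

Fact leavitt_mulA : associative leavitt_mul.
Proof.
move=> x y z; rewrite -[x]clK -[y]clK -[z]clK -!piE.
by apply/leavittP; exact: LMulA.
Qed.

Fact leavitt_mulDl : left_distributive leavitt_mul +%R.
Proof.
move=> x y z; rewrite -[x]clK -[y]clK -[z]clK !addE -!piE.
by apply/leavittP; exact: LMulDl.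
Qed.

Fact leavitt_mulDr : right_distributive leavitt_mul +%R.
Proof.
move=> x y z; rewrite -[x]clK -[y]clK -[z]clK !addE -!piE.
by apply/leavittP; exact: LMulDr.
Qed.

HB.instance Definition _ := Zmodule_isNonUnitalRing.Build leavitt
  leavitt_mulA leavitt_mulDl leavitt_mulDr.

Fact leavitt_scaleA k l x :
  leavitt_scale k (leavitt_scale l x) = leavitt_scale (k * l) x.
Proof. by rewrite -[x]clK -!piE; apply/leavittP; exact: LScaleA. Qed.

Fact leavitt_scale1 : left_id 1 leavitt_scale.
Proof. by move=> x; rewrite -[x]clK -!piE; apply/leavittP; exact: LScale1. Qed.

Fact leavitt_scaleDr : right_distributive leavitt_scale +%R.
Proof.
move=> k x y; rewrite -[x]clK -[y]clK !addE -!piE.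
by apply/leavittP; exact: LScaleDr.
Qed.

Fact leavitt_scaleDl x : {morph leavitt_scale^~ x : k l / k + l}.
Proof.
move=> k l; rewrite -[x]clK !addE -!piE.
by apply/leavittP; exact: LScaleDl.
Qed.

HB.instance Definition _ := GRing.Zmodule_isLmodule.Build K leavitt
  leavitt_scaleA leavitt_scale1 leavitt_scaleDr leavitt_scaleDl.

Fact leavitt_scaleAl (k : K) (x y : leavitt) : k *: (x ** y) = (k *: x) ** y.
Proof.
rewrite -[x]clK -[y]clK; apply/leavittP.
apply: LTrans (LTrans (LCongScale k (lcK _)) (LScaleAl _ _ _)) _.
by apply: LCongMul; [apply: LSym; exact: lcK | exact: LRefl].
Qed.

Fact leavitt_scaleAr (k : K) (x y : leavitt) : k *: (x ** y) = x ** (k *: y).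
Proof.
rewrite -[x]clK -[y]clK; apply/leavittP.
apply: LTrans (LTrans (LCongScale k (lcK _)) (LScaleAr _ _ _)) _.
by apply: LCongMul; [exact: LRefl | apply: LSym; exact: lcK].
Qed.

HB.instance Definition _ := Lmodule_isNonUnitalAlgebra.Build K leavitt
  leavitt_scaleAl leavitt_scaleAr.

Definition leavitt_vertex (v : vertex E) : leavitt := \pi_leavitt (TVertex v).

End Leavitt.

(* Main.v *)
Require Import Defs.
From HB Require Import structures.
From mathcomp Require Import all_boot all_algebra zify.
From mathcomp Require Import boolp classical_sets cardinality functions.

Set Implicit Arguments.
Unset Strict Implicit.
Unset Printing Implicit Defensive.

Import GRing.Theory.
Local Open Scope ring_scope.
Local Open Scope quotient_scope.
Local Open Scope classical_set_scope.

(** The ideas.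

    The algebra L has an anti-automorphism that fixes the vertices and exchanges
    each edge with its ghost.  Twisting by it turns left modules into right
    modules, so the two notions of primitivity coincide and it is enough to
    treat left modules.

    Lower bounds (that some element is not zero, or that two elements differ) come
    from a representation on functions on the set of boundary paths, that is, of
    the paths that are infinite or stop at a sink: an edge e prepends e, and its
    ghost removes it.  In particular every vertex is nonzero ([vtx_neq0]).  Upper
    bounds come from the fact that L is spanned by the monomials p q^* with p and
    q paths that have the same range ([leavitt_ind]).

    Let M be a simple faithful module.  For vertices v and w the group v L w M is
    v M, which is not 0, hence v L w is not 0 and contains a nonzero monomial
    p q^* ; the common range of p and q is the vertex asked for by (MT3)
    ([primitive_MT3]).  If some cycle c based at v had no exit, the corner v L v
    would be commutative ([corner_comm]), and v M would be a simple faithful module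
    over it, so that the nonzero element v - c would be invertible in the corner.
    This is absurd, as v - c kills the infinite path ccc... ([primitive_L]).

    Under Condition (L), any nonzero x can be multiplied on both sides into a nonzero
    multiple of a vertex ([reduction]): multiplying on the right by a path removes
    all ghosts, multiplying on the left by the ghost of a shortest path occurring
    in the result leaves a multiple of a vertex w plus closed paths at w, and
    compressing by a path that leaves a cycle through an exit kills the closed
    paths ([escaping_path]).  So every nonzero ideal contains a vertex; by (MT3)
    two vertices have a common descendant, and that one lies in both ideals.

    Finally, suppose that any two nonzero ideals share a vertex.  Then (MT3) holds
    ([ideals_meet_MT3]).  As there are countably many vertices, (MT3) allows one to
    build a boundary path lam visiting descendants of all vertices
    ([cofinal_path]).  The module spanned by the boundary paths that have a tail in
    common with lam is simple ([tail_class_simple]).  Its annihilator is an ideal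
    that contains no vertex, because each vertex is the source of a path leading
    into lam; so it is 0 ([tail_class_faithful]). *)

(** * Non-unital rings and their modules *)

Section Rings.
Variable R : rngType.
Implicit Types x y z : R.

Lemma rmul0 x : x ** 0 = 0.
Proof. by apply: (addIr (x ** 0)); rewrite -rng_mulDr !add0r. Qed.

Lemma r0mul x : 0 ** x = 0.
Proof. by apply: (addIr (0 ** x)); rewrite -rng_mulDl !add0r. Qed.

Lemma rmulN x y : x ** (- y) = - (x ** y).
Proof. by apply: (addIr (x ** y)); rewrite -rng_mulDr !addNr rmul0. Qed.

Lemma rNmul x y : (- x) ** y = - (x ** y).
Proof. by apply: (addIr (x ** y)); rewrite -rng_mulDl !addNr r0mul. Qed.

Lemma rmul_sumr (I : Type) (s : seq I) (P : pred I) x (F : I -> R) :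
  x ** (\sum_(i <- s | P i) F i) = \sum_(i <- s | P i) x ** F i.
Proof. exact: (big_morph _ (rng_mulDr x) (rmul0 x)). Qed.

Lemma rmul_suml (I : Type) (s : seq I) (P : pred I) x (F : I -> R) :
  (\sum_(i <- s | P i) F i) ** x = \sum_(i <- s | P i) F i ** x.
Proof. exact: (big_morph (fun y => y ** x) (fun y z => rng_mulDl y z x) (r0mul x)). Qed.

Lemma ideal_mull (I : set R) x y : two_sided_ideal I -> I y -> I (x ** y).
Proof. by case=> _ /(_ x y) h /h[]. Qed.

Lemma ideal_mulr (I : set R) x y : two_sided_ideal I -> I y -> I (y ** x).
Proof. by case=> _ /(_ x y) h /h[]. Qed.

Lemma ideal_nonzero (I : set R) :
  two_sided_ideal I -> I <> [set 0]%classic -> exists2 x, I x & x <> 0.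
Proof.
move=> [[I0 _] _] neI; apply: contrapT => noX; apply: neI.
apply/seteqP; split=> [x Ix|x ->//].
by apply: contrapT => x0; apply: noX; exists x.
Qed.

Section Modules.
Variables (M : zmodType) (act : R -> M -> M).
Hypothesis actM : left_module act.

Lemma actDr r m n : act r (m + n) = act r m + act r n.
Proof. by case: actM. Qed.

Lemma actDl r s m : act (r + s) m = act r m + act s m.
Proof. by case: actM. Qed.

Lemma actA r s m : act (r ** s) m = act r (act s m).
Proof. by case: actM. Qed.

Lemma act0l m : act 0 m = 0.
Proof. by apply: (addIr (act 0 m)); rewrite -actDl !add0r. Qed.

Lemma act0r r : act r 0 = 0.
Proof. by apply: (addIr (act r 0)); rewrite -actDr !add0r. Qed.

Lemma actNl r m : act (- r) m = - act r m.
Proof. by apply: (addIr (act r m)); rewrite -actDl !addNr act0l. Qed.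

(** The elements [act r m] form a submodule. *)
Lemma simple_generated m n :
  simple_module act -> (exists r, act r m <> 0) -> exists r, act r m = n.
Proof.
move=> [_ simpM] [r0 r0m].
have sgN : subgroup (range (act^~ m)).
  split=> [|_ _ [r _ <-] [s _ <-]]; first by exists 0; rewrite ?act0l.
  by exists (r - s); rewrite // actDl actNl.
case: (simpM _ sgN) => [r _ [s _ <-]|rN|rN].
- by exists (r ** s); rewrite // actA.
- have : range (act^~ m) (act r0 m) by exists r0.
  by rewrite rN.
- have : range (act^~ m) n by rewrite rN.
  by case=> r _ rm; exists r.
Qed.

End Modules.

End Rings.

(** The simple modules built below are cyclic submodules [R m0] of a big module
    of functions.  The type of elements of [R m0] carries the hypothesis that
    [act] is a module action, since its group structure depends on it. *)
Section Orbit.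
Variables (R : rngType) (M : zmodType) (act : R -> M -> M) (m0 : M).
Hypothesis actM : left_module act.

Definition in_orbit : {pred M} := fun m => `[< exists r, act r m0 = m >].

Fact in_orbit_zmod : zmod_closed in_orbit.
Proof.
split=> [|_ _ /asboolP[r <-] /asboolP[s <-]]; apply/asboolP.
  by exists 0; rewrite (act0l actM).
by exists (r - s); rewrite (actDl actM) (actNl actM).
Qed.

HB.instance Definition _ := GRing.isZmodClosed.Build M in_orbit in_orbit_zmod.

Record orbit_of (phM : left_module act) : predArgType :=
  Orbit { orbit_val : M; _ : orbit_val \in in_orbit }.
Local Notation orbit := (orbit_of actM).
HB.instance Definition _ := [isSub of orbit for @orbit_val actM].
HB.instance Definition _ := [Choice of orbit by <:].
HB.instance Definition _ := [SubChoice_isSubZmodule of orbit by <:].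

Fact orbit_act_subproof r (m : orbit) : act r (val m) \in in_orbit.
Proof.
case: m => _ /= /asboolP[s <-]; apply/asboolP; exists (r ** s).
by rewrite (actA actM).
Qed.

Definition orbit_act r (m : orbit) : orbit := Orbit actM (orbit_act_subproof r m).

Lemma orbit_act_module : left_module orbit_act.
Proof.
have injO : injective (@orbit_val actM) by exact: val_inj.
split=> [r m n|r s m|r s m]; apply: injO => /=.
- by rewrite (actDr actM).
- by rewrite (actDl actM).
- by rewrite (actA actM).
Qed.

(** When every nonzero element of [R m0] can be sent back to [m0], a nonzero
    submodule contains [m0] and so is everything. *)
Lemma primitive_of_orbit :
  (exists r, act r m0 = m0) -> m0 <> 0 ->
  (forall r, act r m0 <> 0 -> exists s, act s (act r m0) = m0) ->
  (forall r, (forall s, act r (act s m0) = 0) -> r = 0) ->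
  left_primitive R.
Proof.
move=> ex_m0 m0_neq0 back faith.
have m0P : m0 \in in_orbit by apply/asboolP.
pose o0 : orbit := Orbit actM m0P.
exists orbit, orbit_act; split; first exact: orbit_act_module.
  split; first by exists o0 => /(congr1 val).
  move=> N [N0 NB] Nact.
  have [[n [Nn n0]]|noN] := pselect (exists n, N n /\ n <> 0); last first.
    left; apply/seteqP; split=> [x Nx|x ->//].
    by apply: contrapT => x0; apply: noN; exists x.
  right; apply/seteqP; split=> // -[m mO] _.
  case: n Nn n0 => n nO Nn n0.
  have /asboolP[r rm0] := nO.
  have [|s sn] := back r.
    by rewrite rm0 => n00; apply: n0; apply: val_inj.
  have /asboolP[t tm0] := mO.
  have -> : Orbit actM mO = orbit_act t (orbit_act s (Orbit actM nO)).
    by apply: val_inj; rewrite /= -rm0 sn tm0.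
  by do 2!apply: (Nact).
move=> r r0; apply: faith => s.
have sP : act s m0 \in in_orbit by apply/asboolP; exists s.
by have /(congr1 val) := r0 (Orbit actM sP).
Qed.

End Orbit.

(** * Monomials and the involution of a Leavitt path algebra *)

Section Generators.
Variables (K : fieldType) (E : graph).
Local Notation L := (leavitt K E).
Implicit Types (v w : vertex E) (e f : edge E) (p q : seq (edge E)).

Definition vtx v : L := leavitt_vertex K v.
Definition edg e : L := \pi_L (TEdge K e).
Definition gho e : L := \pi_L (TGhost K e).

Lemma pi0 : \pi_L (TZero K E) = 0. Proof. by []. Qed.
Lemma piD (a b : lterm K E) : \pi_L (TAdd a b) = \pi_L a + \pi_L b.
Proof. exact: pi_leavitt_add. Qed.
Lemma piN (a : lterm K E) : \pi_L (TOpp a) = - \pi_L a.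
Proof. exact: pi_leavitt_opp. Qed.
Lemma piZ k (a : lterm K E) : \pi_L (TScale k a) = k *: \pi_L a.
Proof. exact: pi_leavitt_scale. Qed.
Lemma piM (a b : lterm K E) : \pi_L (TMul a b) = \pi_L a ** \pi_L b.
Proof. exact: pi_leavitt_mul. Qed.
Lemma pi_big (s : seq (edge E)) (F : edge E -> lterm K E) :
  \pi_L (\big[@TAdd K E/TZero K E]_(e <- s) F e) = \sum_(e <- s) \pi_L (F e).
Proof. exact: (big_morph _ piD pi0). Qed.

Lemma vtxM v w : vtx v ** vtx w = if v == w then vtx v else 0.
Proof.
rewrite /vtx /leavitt_vertex -piM; case: eqVneq => [->|/eqP vw].
  by apply/leavittP; exact: LVertexIdem.
by rewrite -pi0; apply/leavittP; exact: LVertexOrth.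
Qed.

Lemma vtx_edg v e : vtx v ** edg e = if src e == v then edg e else 0.
Proof.
have <- : vtx (src e) ** edg e = edg e.
  by rewrite /vtx /leavitt_vertex -piM; apply/leavittP; exact: LSrcEdge.
by rewrite rng_mulA vtxM eq_sym; case: eqP => [->|]; rewrite ?r0mul.
Qed.

Lemma edg_vtx v e : edg e ** vtx v = if rng e == v then edg e else 0.
Proof.
have <- : edg e ** vtx (rng e) = edg e.
  by rewrite /vtx /leavitt_vertex -piM; apply/leavittP; exact: LEdgeRng.
by rewrite -rng_mulA vtxM; case: eqP => [->|]; rewrite ?rmul0.
Qed.

Lemma vtx_gho v e : vtx v ** gho e = if rng e == v then gho e else 0.
Proof.
have <- : vtx (rng e) ** gho e = gho e.
  by rewrite /vtx /leavitt_vertex -piM; apply/leavittP; exact: LRngGhost.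
by rewrite rng_mulA vtxM eq_sym; case: eqP => [->|]; rewrite ?r0mul.
Qed.

Lemma gho_vtx v e : gho e ** vtx v = if src e == v then gho e else 0.
Proof.
have <- : gho e ** vtx (src e) = gho e.
  by rewrite /vtx /leavitt_vertex -piM; apply/leavittP; exact: LGhostSrc.
by rewrite -rng_mulA vtxM; case: eqP => [->|]; rewrite ?rmul0.
Qed.

Lemma gho_edg e f : gho e ** edg f = if e == f then vtx (rng e) else 0.
Proof.
rewrite -piM; case: eqP => [->|ef].
  by apply/leavittP; exact: LGhostEdge.
by rewrite -pi0; apply/leavittP; exact: LGhostEdge0.
Qed.

Lemma cuntz_krieger v s : s <> [::] -> uniq s -> (forall e, e \in s <-> src e = v) ->
  vtx v = \sum_(e <- s) edg e ** gho e.
Proof.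
move=> s0 us sP; under eq_bigr => e _ do rewrite -piM.
by rewrite -pi_big; apply/leavittP; exact: LCuntzKrieger.
Qed.

Definition ideals_meet := forall I J : set L,
  two_sided_ideal I -> two_sided_ideal J ->
  I <> [set 0]%classic -> J <> [set 0]%classic ->
  exists v : vertex E, I (vtx v) /\ J (vtx v).

(** [pth p w] is the path [p] ending at [w], as an element of the algebra, and
    [gst p w] is its image under the involution.  The end [w] is recorded because
    an empty sequence of edges has to denote the vertex [w]; the product is [0]
    when [p] is not a path ending at [w]. *)
Definition pth p w : L := foldr (fun e x => edg e ** x) (vtx w) p.
Definition gst p w : L := foldr (fun e x => x ** gho e) (vtx w) p.

Definition is_pathb v p w : bool := `[< is_path v p w >].

Lemma is_path_cat v p q w :
  is_path v (p ++ q) w <-> exists2 u, is_path v p u & is_path u q w.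
Proof.
elim: p v => [|e p IH] v /=.
  by split=> [|[u ->]//]; exists v.
split=> [[-> /IH[u pu uq]]|[u [-> pu] uq]]; first by exists u.
by split=> //; apply/IH; exists u.
Qed.

Lemma reachesxx v : reaches v v. Proof. by exists [::]. Qed.

Lemma reaches_trans u v w : reaches u v -> reaches v w -> reaches u w.
Proof. by move=> [p up] [q qv]; exists (p ++ q); apply/is_path_cat; exists v. Qed.

Lemma pth_cons e p w : pth (e :: p) w = edg e ** pth p w. Proof. by []. Qed.
Lemma gst_cons e p w : gst (e :: p) w = gst p w ** gho e. Proof. by []. Qed.

Lemma vtx_pth v p w : vtx v ** pth p w = if is_pathb v p w then pth p w else 0.
Proof.
elim: p v => [|e p IH] v.
  by rewrite /= vtxM /is_pathb /=; case: eqP => [->|vw];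
    [rewrite asboolT|rewrite asboolF // => h; apply: vw].
have IHe : edg e ** pth p w = if is_pathb (rng e) p w then edg e ** pth p w else 0.
  have {1}<- : edg e ** vtx (rng e) = edg e by rewrite edg_vtx eqxx.
  by rewrite -rng_mulA IH; case: ifP; rewrite ?rmul0.
rewrite pth_cons rng_mulA vtx_edg /is_pathb asbool_and; case: eqP => sv; last first.
  by rewrite r0mul asboolF.
by rewrite asboolT //= IHe /is_pathb; case: ifP.
Qed.

Lemma gst_vtx v p w : gst p w ** vtx v = if is_pathb v p w then gst p w else 0.
Proof.
elim: p v => [|e p IH] v.
  by rewrite /= vtxM /is_pathb /= eq_sym; case: eqP => [->|vw];
    [rewrite asboolT|rewrite asboolF // => h; apply: vw].
have IHe : gst p w ** gho e = if is_pathb (rng e) p w then gst p w ** gho e else 0.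
  have {1}<- : vtx (rng e) ** gho e = gho e by rewrite vtx_gho eqxx.
  by rewrite rng_mulA IH; case: ifP; rewrite ?r0mul.
rewrite gst_cons -rng_mulA gho_vtx /is_pathb asbool_and; case: eqP => sv; last first.
  by rewrite rmul0 asboolF.
by rewrite asboolT //= IHe /is_pathb; case: ifP.
Qed.

Lemma pth_vtx v p w : pth p w ** vtx v = if w == v then pth p w else 0.
Proof.
elim: p => [|e p IH] /=; first by rewrite vtxM; case: eqP => [->|].
by rewrite -rng_mulA IH; case: ifP; rewrite ?rmul0.
Qed.

Lemma vtx_gst v p w : vtx v ** gst p w = if w == v then gst p w else 0.
Proof.
elim: p => [|e p IH] /=; first by rewrite vtxM eq_sym; case: eqP => [->|].
by rewrite rng_mulA IH; case: ifP; rewrite ?r0mul.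
Qed.

Lemma edg_pth e p w : ~ is_path (rng e) p w -> edg e ** pth p w = 0.
Proof.
move=> np; have <- : edg e ** vtx (rng e) = edg e by rewrite edg_vtx eqxx.
by rewrite -rng_mulA vtx_pth /is_pathb asboolF ?rmul0.
Qed.

Lemma pth_eq0 p w : (forall v, ~ is_path v p w) -> pth p w = 0.
Proof.
case: p => [/(_ w)[]//|e p np].
by rewrite pth_cons edg_pth // => pw; apply: (np (src e)).
Qed.

Lemma gst_eq0 q w : (forall v, ~ is_path v q w) -> gst q w = 0.
Proof.
case: q => [/(_ w)[]//|e q nq].
have <- : gst (e :: q) w ** vtx (src e) = gst (e :: q) w.
  by rewrite gst_cons -rng_mulA gho_vtx eqxx.
by rewrite gst_vtx /is_pathb asboolF //; exact: nq.
Qed.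

Lemma pth_cat p q u w : is_path u q w -> pth p u ** pth q w = pth (p ++ q) w.
Proof.
move=> uq; elim: p => [|e p IH]; last by rewrite !pth_cons -rng_mulA IH.
by rewrite vtx_pth /is_pathb asboolT.
Qed.

Lemma gst_cat p q u w : is_path u q w -> gst q w ** gst p u = gst (p ++ q) w.
Proof.
move=> uq; elim: p => [|e p IH]; last by rewrite !gst_cons rng_mulA IH.
by rewrite gst_vtx /is_pathb asboolT.
Qed.

Lemma gst_pth p v w : is_path v p w -> gst p w ** pth p w = vtx w.
Proof.
elim: p v => [|e p IH] v; first by rewrite /= vtxM eqxx.
move=> [_ pw]; rewrite gst_cons pth_cons rng_mulA -(rng_mulA _ (gho e)) gho_edg eqxx gst_vtx.
rewrite /is_pathb asboolT //; exact: IH pw.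
Qed.

Lemma gst_pth0 p q w : (size p <= size q)%N -> ~~ prefix p q ->
  gst p w ** pth q w = 0.
Proof.
elim: p q => [|e p IH] [|f q] //; rewrite [(_ <= _)%N]ltnS => spq.
rewrite gst_cons pth_cons rng_mulA -(rng_mulA _ (gho e)) gho_edg.
rewrite [prefix _ _]/=; case: eqP => [->|_ _]; last by rewrite rmul0 r0mul.
by rewrite /= => npq; rewrite gst_vtx; case: ifP => _; rewrite ?r0mul // IH.
Qed.

(** As L is not unital, one cannot just act on [1] by a term: the invariant
    carried through the induction on terms is that the element lies in the span
    of the monomials and that left multiplication by it preserves this span. *)
Lemma leavitt_ind (P : L -> Prop) :
  P 0 -> (forall x y, P x -> P y -> P (x + y)) -> (forall k x, P x -> P (k *: x)) ->
  (forall v v' p q w, is_path v p w -> is_path v' q w -> P (pth p w ** gst q w)) ->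
  forall x, P x.
Proof.
move=> P0 PD PZ Pm.
pose S x := forall Q : L -> Prop,
  Q 0 -> (forall x y, Q x -> Q y -> Q (x + y)) -> (forall k x, Q x -> Q (k *: x)) ->
  (forall v v' p q w, is_path v p w -> is_path v' q w -> Q (pth p w ** gst q w)) -> Q x.
suff SL x : S x by move=> x; exact: SL.
have S0 : S 0 by move=> Q.
have SD x1 y : S x1 -> S y -> S (x1 + y).
  by move=> Sx Sy Q Q0 QD QZ Qm; apply: (QD); [exact: Sx|exact: Sy].
have SZ k x1 : S x1 -> S (k *: x1).
  by move=> Sx Q Q0 QD QZ Qm; apply: (QZ); exact: Sx.
have Sm p q w : S (pth p w ** gst q w).
  move=> Q Q0 QD QZ Qm.
  have [[v pv]|np] := pselect (exists v, is_path v p w); last first.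
    by rewrite pth_eq0 ?r0mul // => v pv; apply: np; exists v.
  have [[v' qv']|nq] := pselect (exists v, is_path v q w); first exact: Qm pv qv'.
  by rewrite gst_eq0 ?rmul0 // => v' qv'; apply: nq; exists v'.
suff [] : S x /\ forall y, S y -> S (x ** y) by [].
have mulS a (g : L) : (forall p q w, S (g ** (pth p w ** gst q w))) ->
    S a -> S (g ** a).
  move=> Sg Sa; apply: (Sa (fun z => S (g ** z))) => [|y z Sy Sz|k y Sy|*].
  - by rewrite rmul0.
  - by rewrite rng_mulDr; apply: SD.
  - by rewrite -rng_scalerAr; apply: SZ.
  - exact: Sg.
rewrite -[x]reprK; elim: (repr x) => [v|e|e||a [Sa aS] b [Sb bS]|a [Sa aS]
    |k a [Sa aS]|a [Sa aS] b [Sb bS]]; split=> [|y Sy].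
- have := Sm [::] [::] v; by rewrite /= vtxM eqxx.
- apply: mulS Sy => p q w; rewrite rng_mulA vtx_pth; case: ifP => _ //.
  by rewrite r0mul.
- by have := Sm [:: e] [::] (rng e); rewrite /= -rng_mulA vtxM eqxx edg_vtx eqxx.
- apply: mulS Sy => p q w; rewrite rng_mulA; exact: (Sm (e :: p)).
- by have := Sm [::] [:: e] (rng e); rewrite /= rng_mulA vtxM eqxx vtx_gho eqxx.
- apply: mulS Sy => -[|f p] q w; rewrite rng_mulA.
    rewrite gho_vtx; case: eqP => [<-|_]; last by rewrite r0mul.
    have -> : gho e = gst [:: e] (rng e) by rewrite /= vtx_gho eqxx.
    rewrite (gst_cat q (q := [:: e])) //.
    have -> : gst (q ++ [:: e]) (rng e) = pth [::] (rng e) ** gst (q ++ [:: e]) (rng e).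
      by rewrite vtx_gst eqxx.
    exact: Sm.
  rewrite pth_cons rng_mulA gho_edg; case: eqP => _; last by rewrite !r0mul.
  by rewrite vtx_pth; case: ifP => _; rewrite ?r0mul.
- by rewrite pi0.
- by rewrite pi0 r0mul.
- by rewrite piD; apply: SD.
- by rewrite piD rng_mulDl; apply: SD; [apply: aS|apply: bS].
- by rewrite piN -scaleN1r; apply: SZ.
- by rewrite piN -scaleN1r -rng_scalerAl; apply: SZ; apply: aS.
- by rewrite piZ; apply: SZ.
- by rewrite piZ -rng_scalerAl; apply: SZ; apply: aS.
- by rewrite piM; apply: aS.
- by rewrite piM -rng_mulA; apply: aS; apply: bS.
Qed.

(** The involution, first on terms. *)
Fixpoint tstar (t : lterm K E) : lterm K E :=
  match t with
  | TVertex v => TVertex K v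
  | TEdge e => TGhost K e
  | TGhost e => TEdge K e
  | TZero => TZero K E
  | TAdd a b => TAdd (tstar a) (tstar b)
  | TOpp a => TOpp (tstar a)
  | TScale k a => TScale k (tstar a)
  | TMul a b => TMul (tstar b) (tstar a)
  end.

Lemma tstarK : involutive tstar.
Proof. by elim=> //= *; congruence. Qed.

Lemma tstar_cong a b : lcong a b -> lcong (tstar a) (tstar b).
Proof.
elim=> /= {a b} *; do ?[exact: LRefl | by apply: LSym | by apply: LCongAdd
  | by apply: LCongOpp | by apply: LCongScale | by apply: LCongMul
  | exact: LAddA | exact: LAddC | exact: LAdd0 | exact: LAddN | exact: LScaleA
  | exact: LScale1 | exact: LScaleDr | exact: LScaleDl | exact: LMulDl
  | exact: LMulDr | exact: LScaleAl | exact: LScaleAr | exact: LVertexIdem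
  | exact: LSrcEdge | exact: LEdgeRng | exact: LRngGhost | exact: LGhostSrc
  | exact: LGhostEdge].
- by apply: LTrans; eassumption.
- by apply: LSym; exact: LMulA.
- by apply: LVertexOrth => ?; congruence.
- by apply: LGhostEdge0 => ?; congruence.
- apply: LTrans; first by apply: LCuntzKrieger; eassumption.
  rewrite (big_morph tstar (id1 := TZero K E) (op1 := @TAdd K E)) //; exact: LRefl.
Qed.

Definition star (x : L) : L := \pi_L (tstar (repr x)).

Lemma star_pi a : star (\pi_L a) = \pi_L (tstar a).
Proof. by apply/leavittP/tstar_cong/leavittP; rewrite reprK. Qed.

Lemma starK : involutive star.
Proof. by move=> x; rewrite {2}/star star_pi tstarK reprK. Qed.

Lemma starD x y : star (x + y) = star x + star y.
Proof. by rewrite -[x]reprK -[y]reprK -piD !star_pi -piD. Qed.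

Lemma starM x y : star (x ** y) = star y ** star x.
Proof. by rewrite -[x]reprK -[y]reprK -piM !star_pi -piM. Qed.

Lemma star0 : star 0 = 0.
Proof. by rewrite -pi0 star_pi. Qed.

Lemma left_primitive_right : left_primitive L -> right_primitive L.
Proof.
move=> [M [act [[aDr aDl aM] [ex simp] faith]]].
exists M, (fun m r => act (star r) m); split.
- by split=> *; rewrite ?starD ?starM.
- split=> // N sN NL; apply: simp => // r m Nm.
  by rewrite -[r]starK; apply: NL.
- by move=> r r0; rewrite -[r]starK [star r]faith ?star0.
Qed.

Lemma right_primitive_left : right_primitive L -> left_primitive L.
Proof.
move=> [M [act [[aDr aDl aM] [ex simp] faith]]].
exists M, (fun r m => act m (star r)); split.
- by split=> *; rewrite ?starD ?starM.
- split=> // N sN NL; apply: simp => // r m Nm.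
  by rewrite -[r]starK; apply: NL.
- by move=> r r0; rewrite -[r]starK [star r]faith ?star0.
Qed.

End Generators.

(** * Representations on branching systems *)

(** A branching system partitions its points into the ranges of the injections
    [pcons e], defined on the points with base [rng e], and points based at sinks.
    This is exactly what makes functions on the points a module; the functions
    are not required to have finite support, so that no sums are needed to
    describe the action of the generators. *)
Record branching (E : graph) := Branching {
  pt : Type;
  base : pt -> vertex E;
  head : pt -> option (edge E);
  tail : pt -> pt;
  pcons : edge E -> pt -> pt;
  src_head : forall x e, head x = Some e -> src e = base x;
  base_tail : forall x e, head x = Some e -> base (tail x) = rng e;
  pcons_tail : forall x e, head x = Some e -> pcons e (tail x) = x;
  head_pcons : forall x e, base x = rng e -> head (pcons e x) = Some e;
  tail_pcons : forall x e, base x = rng e -> tail (pcons e x) = x;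
  head_sink : forall x e, head x = None -> src e <> base x
}.

Section Representation.
Variables (K : fieldType) (E : graph) (B : branching E).
Local Notation L := (leavitt K E).
Local Notation F := (pt B -> K^o).
Implicit Types (f g : F) (x : pt B).

Fixpoint ev (t : lterm K E) (f : F) : F :=
  match t with
  | TVertex v => fun x => if base x == v then f x else 0
  | TEdge e => fun x => if head x == Some e then f (tail x) else 0
  | TGhost e => fun x => if base x == rng e then f (pcons e x) else 0
  | TZero => 0
  | TAdd a b => ev a f + ev b f
  | TOpp a => - ev a f
  | TScale k a => k *: ev a f
  | TMul a b => ev a (ev b f)
  end.

Lemma evD t f g : ev t (f + g) = ev t f + ev t g.
Proof.
elim: t f g => [v|e|e||a IHa b IHb|a IHa|k a IHa|a IHa b IHb] f g /=.
1-3: by apply/funext => x; rewrite !fctE; case: ifP; rewrite ?addr0.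
- by rewrite addr0.
- by rewrite IHa IHb addrACA.
- by rewrite IHa opprD.
- by rewrite IHa scalerDr.
- by rewrite IHb IHa.
Qed.

Lemma evZ t k f : ev t (k *: f) = k *: ev t f.
Proof.
elim: t f => [v|e|e||a IHa b IHb|a IHa|l a IHa|a IHa b IHb] f /=.
1-3: by apply/funext => x; rewrite !fctE; case: ifP; rewrite ?scaler0.
- by rewrite scaler0.
- by rewrite IHa IHb scalerDr.
- by rewrite IHa scalerN.
- by rewrite IHa !scalerA mulrC.
- by rewrite IHb IHa.
Qed.

(** The relations hold pointwise.  In the Cuntz-Krieger relation at the base of a
    point, exactly one summand is nonzero at this point: the one of its head. *)
Lemma ev_cong a b : lcong a b -> ev a = ev b.
Proof.
move=> ab; apply/funext => f; elim: ab f => {a b} //=.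
- by move=> a b c _ ab _ bc f; rewrite ab.
- by move=> a a' b b' _ IHa _ IHb f; rewrite IHa IHb.
- by move=> a a' _ IH f; rewrite IH.
- by move=> k a a' _ IH f; rewrite IH.
- by move=> a a' b b' _ IHa _ IHb f; rewrite IHa IHb.
- by move=> a b c f; rewrite addrA.
- by move=> a b f; rewrite addrC.
- by move=> a f; rewrite add0r.
- by move=> a f; rewrite addNr.
- by move=> k l a f; rewrite scalerA.
- by move=> a f; rewrite scale1r.
- by move=> k a b f; rewrite scalerDr.
- by move=> k l a f; rewrite scalerDl.
- by move=> a b c f; rewrite evD.
- by move=> k a b f; rewrite evZ.
- by move=> v f; apply/funext => x; case: eqP.
- by move=> v w vw f; apply/funext => x; case: eqP => // ->; case: eqP.
- move=> e f; apply/funext => x; case: (head x =P Some e) => he.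
    by rewrite (src_head he) eqxx.
  by case: ifP.
- move=> e f; apply/funext => x; case: (head x =P Some e) => // he.
  by rewrite (base_tail he) eqxx.
- by move=> e f; apply/funext => x; case: eqP.
- move=> e f; apply/funext => x; case: eqP => // bx.
  by rewrite (src_head (head_pcons bx)) eqxx.
- move=> e f; apply/funext => x; case: eqP => // bx.
  by rewrite (head_pcons bx) eqxx (tail_pcons bx).
- move=> e e' ee' f; apply/funext => x; case: eqP => // bx.
  by rewrite (head_pcons bx); case: eqP => // -[].
- move=> v s s0 us sP f; apply/funext => x.
  have -> : ev (\big[@TAdd K E/TZero K E]_(e <- s) TMul (TEdge K e) (TGhost K e)) f
     = \sum_(e <- s) ev (TMul (TEdge K e) (TGhost K e)) f.
    exact: (big_morph (ev^~ f)).
  rewrite fct_sumE.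
  have termE e : ev (TMul (TEdge K e) (TGhost K e)) f x
      = if head x == Some e then f x else 0.
    rewrite /=; case: eqP => // he.
    by rewrite (base_tail he) eqxx (pcons_tail he).
  under eq_bigr => e _ do rewrite termE.
  case: eqP => bv; last first.
    rewrite big_seq big1 // => e /sP se; case: eqP => // /src_head he.
    by case: bv; rewrite -he.
  case he: (head x) => [e|].
    rewrite (bigD1_seq e) //= ?eqxx; last by apply/sP; rewrite (src_head he).
    by rewrite big1 ?addr0 // => e' ne; case: eqP => // -[ee]; rewrite ee eqxx in ne.
  case: s s0 sP {us} => // e s _ sP; case: (head_sink (e := e) he).
  by rewrite bv; apply/sP; rewrite mem_head.
Qed.

Definition bact (x : L) : F -> F := ev (repr x).

Lemma bact_pi t : bact (\pi_L t) = ev t.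
Proof. by apply/ev_cong/leavittP; rewrite reprK. Qed.

Lemma bact_module : left_module bact.
Proof.
split=> [r f g|r s f|r s f]; first exact: evD.
- by rewrite -[r]reprK -[s]reprK -piD !bact_pi.
- by rewrite -[r]reprK -[s]reprK -piM !bact_pi.
Qed.

Lemma bactZ r k f : bact r (k *: f) = k *: bact r f.
Proof. exact: evZ. Qed.

Lemma bact_scale r k f : bact (k *: r) f = k *: bact r f.
Proof. by rewrite -[r]reprK -piZ !bact_pi. Qed.

Lemma bact_vtx v f : bact (vtx K v) f = fun x => if base x == v then f x else 0.
Proof. by rewrite /vtx /leavitt_vertex bact_pi. Qed.

Lemma bact_edg e f :
  bact (edg K e) f = fun x => if head x == Some e then f (tail x) else 0.
Proof. by rewrite /edg bact_pi. Qed.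

Lemma bact_gho e f :
  bact (gho K e) f = fun x => if base x == rng e then f (pcons e x) else 0.
Proof. by rewrite /gho bact_pi. Qed.

End Representation.

(** * Boundary paths *)

Section Boundary.
Variable E : graph.
Local Notation ext := (edge E + vertex E)%type.

Definition sink (v : vertex E) := forall e, src e <> v.

(** A loop is added at each sink, as the step [inr w].  Finite paths into a sink
    then become infinite paths that stay there, and no case distinction on the
    length of a boundary path is necessary. *)
Definition xsrc (a : ext) := match a with inl e => src e | inr w => w end.
Definition xrng (a : ext) := match a with inl e => rng e | inr w => w end.
Definition xok (a : ext) := if a is inr w then sink w else True.

Definition boundary (x : nat -> ext) :=
  forall n, xok (x n) /\ xrng (x n) = xsrc (x n.+1).

Definition bpath := {x : nat -> ext | boundary x}.

Definition bbase (x : bpath) := xsrc (sval x 0).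
Definition bhead (x : bpath) := if sval x 0 is inl e then Some e else None.

Definition shift k (x : nat -> ext) : nat -> ext := fun n => x (k + n)%N.

Lemma boundary_shift k x : boundary x -> boundary (shift k x).
Proof. by move=> bx n; rewrite /shift addnS; exact: bx. Qed.

Definition bshift k (x : bpath) : bpath :=
  exist _ (shift k (sval x)) (boundary_shift k (svalP x)).
Definition btail := bshift 1.

Definition scons (a : ext) (x : nat -> ext) : nat -> ext :=
  fun n => if n is m.+1 then x m else a.

Lemma boundary_scons a x :
  xok a -> xrng a = xsrc (x 0%N) -> boundary x -> boundary (scons a x).
Proof. by move=> oka ax bx [|n] //=; exact: bx. Qed.

(** The value [x] when [e] cannot be put in front of [x] is arbitrary. *)
Definition bcons (e : edge E) (x : bpath) : bpath :=
  match pselect (rng e = bbase x) with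
  | left ex => exist _ (scons (inl e) (sval x)) (boundary_scons (a := inl e) I ex (svalP x))
  | right _ => x
  end.

Lemma bpath_ext (x y : bpath) : sval x =1 sval y -> x = y.
Proof.
case: x y => [x bx] [y b_y] /= /funext xy; case: _ / xy in b_y *.
by congr exist; exact: Prop_irrelevance.
Qed.

Lemma bconsE e x : bbase x = rng e -> sval (bcons e x) = scons (inl e) (sval x).
Proof. by move=> h; rewrite /bcons; case: pselect => [//|/(_ (esym h))]. Qed.

Program Definition boundary_system : branching E :=
  @Branching E bpath bbase bhead btail bcons _ _ _ _ _ _.
Next Obligation. by move: H; rewrite /bhead /bbase; case: (sval x 0%N) => // ? []->. Qed.
Next Obligation.
move: H; rewrite /bhead /bbase /= /shift addn0; have [_] := svalP x 0%N.
by case: (sval x 0%N) => // ? <- []->.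
Qed.
Next Obligation.
have be : bbase (btail x) = rng e.
  move: H; rewrite /bhead /bbase /= /shift addn0; have [_] := svalP x 0%N.
  by case: (sval x 0%N) => // ? <- []->.
apply: bpath_ext => n; rewrite bconsE //; case: n => //=.
by move: H; rewrite /bhead; case: (sval x 0%N) => // ? []->.
Qed.
Next Obligation. by rewrite /bhead bconsE. Qed.
Next Obligation. by apply: bpath_ext => n; rewrite /= /shift bconsE. Qed.
Next Obligation.
move: H; rewrite /bhead /bbase; have [+ _] := svalP x 0%N.
by case: (sval x 0%N) => // w /= sw _; exact: sw.
Qed.

(** A boundary path from [v], obtained by always taking the same chosen edge out of
    a vertex.  On a cycle without exit this is the path that goes round for ever. *)
Definition chosen_step (v : vertex E) : ext :=
  match pselect (exists e, src e = v) with
  | left ex => inl (projT1 (cid ex))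
  | right _ => inr v
  end.

Lemma xsrc_chosen_step v : xsrc (chosen_step v) = v.
Proof. by rewrite /chosen_step; case: pselect => // ex /=; case: cid. Qed.

Lemma xok_chosen_step v : xok (chosen_step v).
Proof. by rewrite /chosen_step; case: pselect => // nex e ev; apply: nex; exists e. Qed.

Definition chosen (v : vertex E) : nat -> ext :=
  fun n => chosen_step (iter n (fun u => xrng (chosen_step u)) v).

Lemma boundary_chosen v : boundary (chosen v).
Proof. by move=> n; split; [exact: xok_chosen_step | rewrite /chosen xsrc_chosen_step]. Qed.

Definition chosen_bpath v : bpath := exist _ (chosen v) (boundary_chosen v).

Lemma bbase_chosen v : bbase (chosen_bpath v) = v.
Proof. exact: xsrc_chosen_step. Qed.

Lemma chosen_cons e :
  chosen_step (src e) = inl e -> chosen_bpath (src e) = bcons e (chosen_bpath (rng e)).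
Proof.
move=> ne; apply: bpath_ext => n; rewrite bconsE ?bbase_chosen //.
by case: n => [//|n]; rewrite /= /chosen iterSr ne.
Qed.

End Boundary.

(** The integer label counts the edges that were added.  It reflects the grading
    of the algebra, and distinguishes a cycle without exit from its base vertex although
    both fix the periodic path. *)
Section Labelled.
Variables (E : graph) (B : branching E).

Program Definition labelled : branching E :=
  @Branching E (pt B * int)%type (fun x => base x.1) (fun x => head x.1)
    (fun x => (tail x.1, x.2 - 1)) (fun e x => (pcons e x.1, x.2 + 1))
    _ _ _ _ _ _.
Next Obligation. exact: src_head. Qed.
Next Obligation. exact: base_tail. Qed.
Next Obligation. by rewrite /= pcons_tail // subrK. Qed.
Next Obligation. exact: head_pcons. Qed.
Next Obligation. by rewrite /= tail_pcons // addrK. Qed.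
Next Obligation. by move=> sb; apply: head_sink sb. Qed.

End Labelled.

Section Consequences.
Variables (K : fieldType) (E : graph).
Local Notation L := (leavitt K E).
Local Notation BS := (boundary_system E).

Lemma vtx_neq0 v : vtx K v <> 0 :> L.
Proof.
move=> v0; have := congr1 (fun r => bact (B := BS) r (fun=> 1) (chosen_bpath v)) v0.
rewrite bact_vtx /= bbase_chosen eqxx (act0l (@bact_module K E BS)).
by apply/eqP; rewrite oner_eq0.
Qed.

(** On functions of this form, a path made of chosen edges acts by translating
    [phi] by its length.  A constant [phi] is fixed by a closed path, whereas the
    indicator of [0] is moved. *)
Definition ray (v : vertex E) (phi : int -> K) : pt (labelled BS) -> K^o :=
  fun x => if `[< x.1 = chosen_bpath v >] then phi x.2 else 0.

Lemma bact_pth_ray v p w phi :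
  is_path v p w -> (forall e, e \in p -> chosen_step (src e) = inl e) ->
  bact (pth K p w) (ray w phi) = ray v (fun z => phi (z - (size p)%:Z)).
Proof.
move=> + np; elim: p v np => [|e p IH] v np.
  move=> <-; rewrite [pth _ _ _]/= bact_vtx; apply/funext => -[x z] /=.
  rewrite /ray /= subr0; case: asboolP => [->|_]; last by case: ifP.
  by rewrite bbase_chosen eqxx.
move=> [<- pw]; rewrite pth_cons (actA (@bact_module K E _)) (IH _ _ pw); last first.
  by move=> f fp; apply: np; rewrite inE fp orbT.
rewrite bact_edg; apply/funext => -[x z]; rewrite /ray /=.
have ne : chosen_step (src e) = inl e by apply: np; rewrite mem_head.
case: eqP => [he|he].
  have -> : `[< btail x = chosen_bpath (rng e) >] = `[< x = chosen_bpath (src e) >].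
    apply/asbool_equiv_eq; rewrite chosen_cons //; split=> [tx|->].
      by rewrite -[x](@pcons_tail _ BS _ _ he) -tx.
    by apply: (@tail_pcons _ BS); rewrite /= bbase_chosen.
  by rewrite -addrA -opprD intS.
case: asboolP => // xe; case: he; rewrite xe chosen_cons //.
by apply: (@head_pcons _ BS); rewrite /= bbase_chosen.
Qed.

End Consequences.

(** * Primitivity forces Conditions (L) and (MT3) *)

Section Deterministic.
Variables (K : fieldType) (E : graph) (S : vertex E -> Prop).
Local Notation L := (leavitt K E).
Local Notation pth := (pth K).
Local Notation gst := (gst K).
Hypothesis S_src : forall e f : edge E, S (src e) -> src f = src e -> f = e.
Hypothesis S_rng : forall e : edge E, S (src e) -> S (rng e).

Lemma det_prefix v p q w w' : S v -> is_path v p w -> is_path v q w' ->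
  (size p <= size q)%N -> exists2 d, q = p ++ d & is_path w d w'.
Proof.
elim: p v q => [|e p IH] v q Sv; first by move=> <- vq _; exists q.
case: q => // f q [ev pw] [fv qw'] spq.
have fe : f = e by apply: S_src; rewrite ?ev ?fv.
rewrite fe in qw'.
have [|d -> wd] := IH _ _ _ pw qw' spq; first by apply: S_rng; rewrite ev.
by exists d; rewrite // fe.
Qed.

Lemma S_path v p w : S v -> is_path v p w -> S w.
Proof.
elim: p v => [|e p IH] v Sv /= => [<-//|[ev]]; apply: IH.
by apply: S_rng; rewrite ev.
Qed.

(** Each vertex on the path emits one edge only, so each Cuntz-Krieger relation
    used here has a single summand. *)
Lemma det_pth_gst v p w : S v -> is_path v p w -> pth p w ** gst p w = vtx K v.
Proof.
elim: p v => [|e p IH] v Sv; first by move=> <-; rewrite /= vtxM eqxx.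
move=> [ev pw]; rewrite pth_cons gst_cons -rng_mulA (rng_mulA (pth p w)).
rewrite (IH _ _ pw); last by apply: S_rng; rewrite ev.
rewrite vtx_gho eqxx (@cuntz_krieger _ _ v [:: e]) ?big_seq1 // => f.
rewrite inE; split=> [/eqP->//|fv]; apply/eqP.
by apply: S_src; rewrite ?ev.
Qed.

(** When at most one path of each length leaves [v], a monomial [a b^*] in the
    corner at [v] depends on the difference of the lengths of [a] and [b] only.
    These differences add up in products, so that the corner is commutative.  For
    [v] on a cycle without exit it is the ring of Laurent polynomials in the cycle. *)
Definition corner_mono v (x : L) a b := exists w, [/\ is_path v a w, is_path v b w
   & x = pth a w ** gst b w].

Lemma corner_mono_eq v x x' a b a' b' :
  S v -> corner_mono v x a b -> corner_mono v x' a' b' ->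
  (size a + size b' = size a' + size b)%N -> x = x'.
Proof.
wlog aa' : x x' a b a' b' / (size a <= size a')%N => [H|].
  case: (leqP (size a) (size a')) => [|/ltnW] le Sv vx vx' ab; first exact: H vx vx' ab.
  by apply/esym; apply: H vx' vx _.
move=> Sv [w [va vb ->]] [w' [va' vb' ->]] ab.
have [d da' wd] := det_prefix Sv va va' aa'.
have bb' : (size b <= size b')%N.
  by rewrite -(leq_add2l (size a)) ab leq_add2r.
have [d' db' wd'] := det_prefix Sv vb vb' bb'.
have dd' : d' = d.
  have sd : size d = size d' by move: ab; rewrite da' db' !size_cat; lia.
  have [|t dt _] := det_prefix (S_path Sv va) wd wd'; first by rewrite sd.
  case: t dt => [|e t] dt; first by rewrite dt cats0.
  by move: sd; rewrite dt size_cat /=; lia.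
rewrite da' db' dd' -(pth_cat K _ wd) -(gst_cat K _ wd) -rng_mulA (rng_mulA (pth d w')).
rewrite (det_pth_gst _ wd) ?vtx_gst ?eqxx //; exact: S_path va.
Qed.

Lemma corner_monoM v x x' a b a' b' :
  S v -> corner_mono v x a b -> corner_mono v x' a' b' ->
  exists a'' b'', corner_mono v (x ** x') a'' b'' /\
    (size a'' + size b + size b' = size b'' + size a + size a')%N.
Proof.
move=> Sv [w [va vb ->]] [w' [va' vb' ->]].
case: (leqP (size b) (size a')) => [|/ltnW] le.
  have [d dE wd] := det_prefix Sv vb va' le.
  exists (a ++ d), b'; split; last by rewrite dE !size_cat; lia.
  exists w'; split=> //; first by apply/is_path_cat; exists w.
  rewrite dE -(pth_cat K _ wd) -rng_mulA (rng_mulA (gst b w)) (rng_mulA (gst b w)).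
  rewrite (gst_pth K vb) vtx_pth /is_pathb asboolT // rng_mulA.
  by rewrite (pth_cat K _ wd).
have [d dE wd] := det_prefix Sv va' vb le.
exists a, (b' ++ d); split; last by rewrite dE !size_cat; lia.
exists w; split=> //; first by apply/is_path_cat; exists w'.
rewrite dE -(gst_cat K _ wd) -rng_mulA -(rng_mulA (gst d w)) (rng_mulA (gst a' w')).
rewrite (gst_pth K va') vtx_gst eqxx.
by rewrite (gst_cat K _ wd).
Qed.

Lemma corner_comm v (x y : L) : S v ->
  (vtx K v ** x ** vtx K v) ** (vtx K v ** y ** vtx K v) =
  (vtx K v ** y ** vtx K v) ** (vtx K v ** x ** vtx K v).
Proof.
move=> Sv; set c := fun z : L => vtx K v ** z ** vtx K v.
have c0 : c 0 = 0 by rewrite /c rmul0 r0mul.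
have cD x1 y1 : c (x1 + y1) = c x1 + c y1 by rewrite /c rng_mulDr rng_mulDl.
have cZ k x1 : c (k *: x1) = k *: c x1 by rewrite /c -rng_scalerAr -rng_scalerAl.
have cm p q w : c (pth p w ** gst q w) = 0 \/
   corner_mono v (c (pth p w ** gst q w)) p q.
  rewrite /c rng_mulA vtx_pth -rng_mulA gst_vtx.
  case: ifPn => [/asboolP vp|_]; last by left; rewrite r0mul.
  case: ifPn => [/asboolP vq|_]; last by left; rewrite rmul0.
  by right; exists w.
rewrite -/(c x) -/(c y).
elim/leavitt_ind: x => [|x x' IH IH'|k x IH|u u' p q w _ _].
- by rewrite c0 r0mul rmul0.
- by rewrite cD rng_mulDl rng_mulDr IH IH'.
- by rewrite cZ -rng_scalerAl -rng_scalerAr IH.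
elim/leavitt_ind: y => [|y y' IH IH'|k y IH|u1 u1' p1 q1 w1 _ _].
- by rewrite c0 r0mul rmul0.
- by rewrite cD rng_mulDl rng_mulDr IH IH'.
- by rewrite cZ -rng_scalerAl -rng_scalerAr IH.
case: (cm p q w) => [->|m1]; first by rewrite r0mul rmul0.
case: (cm p1 q1 w1) => [->|m2]; first by rewrite r0mul rmul0.
have [a [b [m12 s12]]] := corner_monoM Sv m1 m2.
have [a' [b' [m21 s21]]] := corner_monoM Sv m2 m1.
by apply: corner_mono_eq m12 m21 _ => //; lia.
Qed.

End Deterministic.

Section Primitive.
Variables (K : fieldType) (E : graph).
Local Notation L := (leavitt K E).
Local Notation BS := (boundary_system E).

Lemma ray_neq0 v phi z : phi z <> 0 -> ray (K := K) (E := E) v phi <> 0.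
Proof.
move=> pz /(congr1 (fun h => h (chosen_bpath v, z))).
by rewrite /ray /= asboolT.
Qed.

Lemma vtx_ray v phi : bact (vtx K v) (ray v phi) = ray (K := K) (E := E) v phi.
Proof.
rewrite bact_vtx; apply/funext => -[x z] /=; rewrite /ray /=.
by case: asboolP => [->|_]; rewrite ?bbase_chosen ?eqxx //; case: ifP.
Qed.

Lemma rng_in_cycle v p w (e : edge E) : is_path v p w -> e \in p ->
  rng e = w \/ rng e \in map src p.
Proof.
elim: p v => // f p IH v [_ pw]; rewrite inE => /orP[/eqP->|/(IH _ pw)[->|ep]].
- case: p pw {IH} => [/= ->|g p [<- _]]; first by left.
  by right; rewrite /= !inE eqxx orbT.
- by left.
- by right; rewrite /= inE ep orbT.
Qed.

(** In the simple module of a commutative ring, a nonzero element acts as a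
    bijection whose inverse is again given by the ring: here [b] inverts [v - c]
    in the corner. *)
Lemma primitive_L : left_primitive L -> condition_L E.
Proof.
move=> [M [act [actM simpM faith]]] p [p0 [v vp] _].
apply: contrapT => noexit.
have inp e f : f \in p -> src e = src f -> e = f.
  by move=> fp ef; apply: contrapT => ne; apply: noexit; exists e, f.
pose S u := u \in map src p.
have Sv : S v.
  rewrite /S; case: p p0 vp {S noexit inp} => // f p _ [<- _].
  by rewrite /= inE eqxx.
have S_src e f : S (src e) -> src f = src e -> f = e.
  move=> /mapP[g gp eg] fe.
  by rewrite (inp e g) // (inp f g) // fe.
have S_rng e : S (src e) -> S (rng e).
  move=> /mapP[g gp eg]; rewrite (inp e g) //.
  by case: (rng_in_cycle vp gp) => [->|].
have nextp e : e \in p -> chosen_step (src e) = inl e.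
  move=> ep; rewrite /chosen_step; case: pselect => [ex|[]]; last by exists e.
  by case: cid => f fe /=; rewrite (inp f e).
set V := vtx K v; set c := pth K p v.
have VV : V ** V = V by rewrite vtxM eqxx.
have Vc : V ** c = c by rewrite vtx_pth /is_pathb asboolT.
have cV : c ** V = c by rewrite pth_vtx eqxx.
have c_ray phi : bact c (ray v phi) = ray v (fun z => phi (z - (size p)%:Z)).
  exact: bact_pth_ray.
pose a := V - c.
have Va : V ** a = a by rewrite rng_mulDr rmulN VV Vc.
have aV : a ** V = a by rewrite rng_mulDl rNmul VV cV.
have labM := @bact_module K E (labelled BS).
have a_neq0 : a <> 0.
  (* [c] moves the indicator of the label [0] to the label [size p], which is not [0]. *)
  pose phi (z : int) : K := (z == 0)%:R.
  move=> /(congr1 (fun r => bact r (ray v phi) (chosen_bpath v, 0))).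
  rewrite (act0l labM) (actDl labM) (actNl labM) vtx_ray c_ray /ray /=.
  rewrite !fctE /= asboolT // /phi eqxx sub0r oppr_eq0.
  case: p p0 {noexit inp vp Sv S_src S_rng nextp c Vc cV c_ray a Va aV} @S => // f p _ _.
  by rewrite /= subr0 => /eqP; rewrite oner_eq0.
have [m' am'] : exists m', act a m' <> 0.
  apply: contrapT => na; apply: a_neq0; apply: faith => m.
  by apply: contrapT => am; apply: na; exists m.
pose m1 := act V m'.
have am1 : act a m1 = act a m' by rewrite /m1 -(actA actM) aV.
have Vm1 : act V m1 = m1 by rewrite /m1 -(actA actM) VV.
clearbody m1.
have m1_neq0 : m1 <> 0 by move=> m10; apply: am'; rewrite -am1 m10 (act0r actM).
have [|r rm] := @simple_generated _ _ _ actM (act a m1) m1 simpM.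
  apply: contrapT => nr; apply: am'; rewrite -am1 -Va (actA actM).
  by apply: contrapT => h; apply: nr; exists V.
pose b := V ** r ** V.
(* [z] kills [m1]; as it commutes with the corner it kills the whole module, so
   that [b] inverts [a]. *)
pose z := b ** a - V.
have zm1 : act z m1 = 0.
  rewrite (actDl actM) (actNl actM) Vm1 !(actA actM).
  rewrite -[act V (act a m1)](actA actM) Va rm.
  by rewrite Vm1 subrr.
have zV : V ** z ** V = z.
  have Vb : V ** b = b by rewrite !rng_mulA VV.
  by rewrite rng_mulDr rmulN rng_mulDl rNmul rng_mulA Vb -rng_mulA aV !VV.
have z0 : z = 0.
  apply: faith => m.
  have [|s <-] := @simple_generated _ _ _ actM m1 m simpM; first by exists V; rewrite Vm1.
  rewrite -zV -Vm1 -!(actA actM).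
  have -> : V ** z ** V ** s ** V = V ** s ** V ** z.
    rewrite -[in RHS]zV -[LHS]rng_mulA.
    have := @corner_comm K E S S_src S_rng v z s Sv; rewrite -/V.
    by rewrite !rng_mulA -!(rng_mulA _ V V) VV.
  by rewrite (actA actM) zm1 (act0r actM).
(* But [a] is not injective on functions: it kills the ray with constant labels. *)
have bact_a : bact a (ray v (fun=> 1)) = 0.
  by rewrite (actDl labM) (actNl labM) vtx_ray c_ray subrr.
have := congr1 (fun r => bact r (ray v (fun=> 1))) z0.
rewrite (act0l labM) (actDl labM) (actNl labM) vtx_ray (actA labM) bact_a.
rewrite (act0r labM) sub0r => /eqP; rewrite oppr_eq0 => /eqP.
by apply: (@ray_neq0 _ _ 0); apply/eqP; rewrite oner_eq0.
Qed.

Lemma corner_reaches v w (x : L) : vtx K v ** x ** vtx K w <> 0 ->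
  exists y, reaches v y /\ reaches w y.
Proof.
move=> xn0; apply: contrapT => noy; apply: xn0.
elim/leavitt_ind: x => [|x y IHx IHy|k x IHx|u u' p q y _ _].
- by rewrite rmul0 r0mul.
- by rewrite rng_mulDr rng_mulDl IHx IHy addr0.
- by rewrite -rng_scalerAr -rng_scalerAl IHx scaler0.
rewrite rng_mulA vtx_pth -rng_mulA gst_vtx.
case: ifPn => [/asboolP vp|_]; last by rewrite r0mul.
case: ifPn => [/asboolP vq|_]; last by rewrite rmul0.
by case: noy; exists y; split; [exists p|exists q].
Qed.

(** [v L w] is not [0]: from a nonzero [w m] one reaches every element of the
    module, in particular one that [v] does not kill. *)
Lemma primitive_MT3 : left_primitive L -> condition_MT3 E.
Proof.
move=> [M [act [actM simpM faith]]] v w.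
have nz u : exists m, act (vtx K u) m <> 0.
  apply: contrapT => na; apply: (@vtx_neq0 K E u); apply: faith => m.
  by apply: contrapT => am; apply: na; exists m.
have [m wm] := nz w; have [n vn] := nz v.
have [|x xm] := @simple_generated _ _ _ actM (act (vtx K w) m) n simpM.
  by exists (vtx K w); rewrite -(actA actM) vtxM eqxx.
apply: (@corner_reaches v w x) => h; apply: vn.
by rewrite -xm -!(actA actM) h (act0l actM).
Qed.

End Primitive.

(** * The reduction theorem *)

Lemma uniq_map_inj (T T' : eqType) (f : T -> T') s x y :
  uniq (map f s) -> x \in s -> y \in s -> f x = f y -> x = y.
Proof.
elim: s => //= a s IH /andP[fa us]; rewrite !inE.
move=> /orP[/eqP->|xs] /orP[/eqP->|ys] // fxy; last exact: IH.
- by rewrite fxy map_f in fa.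
- by rewrite -fxy map_f in fa.
Qed.

Section Exits.
Variable E : graph.
Implicit Types (v w : vertex E) (p q : seq (edge E)).

(** A repeated source allows one to cut out a closed piece and to obtain a shorter
    closed path at the same vertex. *)
Lemma closed_path_cycle v p : p <> [::] -> is_path v p v ->
  exists2 g, is_cycle g & is_path v g v.
Proof.
have [n] := ubnP (size p); elim: n p => // n IH p sp p0 vp.
have [us|nus] := boolP (uniq (map src p)).
  by exists p => //; split=> //; exists v.
have e0 : edge E by case: p p0 {sp vp nus}.
have /(uniqPn (src e0))[i [j [ij jp]]] := nus.
rewrite size_map in jp; have ip := ltn_trans ij jp.
rewrite !(nth_map e0) // => eij.
have jE : is_path v (take j p ++ nth e0 p j :: drop j.+1 p) v.
  by rewrite -drop_nth // cat_take_drop.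
have iE : is_path v (take i p ++ nth e0 p i :: drop i.+1 p) v.
  by rewrite -drop_nth // cat_take_drop.
have /is_path_cat[u vu [su _]] := iE.
have /is_path_cat[u' vu' [su' du']] := jE.
apply: (IH (take i p ++ nth e0 p j :: drop j.+1 p)).
- by rewrite size_cat /= size_drop size_take ip; lia.
- by case: (take i p).
- by apply/is_path_cat; exists u => //; split=> //; rewrite -eij.
Qed.

(** The path [t] follows a cycle for at least [N] steps and then leaves it
    through an exit [f].  If [t] were a prefix of [d ++ t], then [t] would
    have period [size d], and [f] would occur earlier in [t], that is, on the
    cycle.  Without closed paths at [v] there is nothing to escape from. *)
Lemma escaping_path v N : condition_L E ->
  exists t u, is_path v t u /\
    forall d, d <> [::] -> (size d <= N)%N -> is_path v d v -> ~~ prefix t (d ++ t).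
Proof.
move=> EL.
have [[p [p0 vp]]|ncl] := pselect (exists p, p <> [::] /\ is_path v p v); last first.
  exists [::], v; split=> // d d0 _ vd; case: ncl; by exists d.
have [g cg vg] := closed_path_cycle p0 vp.
have [f [h [hg fh nfh]]] := EL _ cg.
have fg : f \notin g.
  by apply/negP => fg; apply: nfh; have [_ _ us] := cg; exact: uniq_map_inj us _ _ fh.
have gN M : is_path v (flatten (nseq M g)) v.
  by elim: M => //= M IH; apply/is_path_cat; exists v.
pose g1 := take (index h g) g.
have gE : is_path v (g1 ++ h :: drop (index h g).+1 g) v.
  have ih : (index h g < size g)%N by rewrite index_mem.
  have <- : drop (index h g) g = h :: drop (index h g).+1 g.
    by rewrite (drop_nth h) // nth_index.
  by rewrite cat_take_drop.
have /is_path_cat[u vu [hu _]] := gE.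
pose s := flatten (nseq N g) ++ g1.
have sg e : e \in s -> e \in g.
  rewrite mem_cat => /orP[|/mem_take//].
  by elim: N {s} => //= N IH; rewrite mem_cat => /orP[].
have sN : (N <= size s)%N.
  have g_gt0 : (0 < size g)%N by case: (g) hg.
  rewrite size_cat size_flatten /shape map_nseq sumn_nseq.
  by apply: leq_trans (leq_addr _ _); rewrite leq_pmull.
exists (rcons s f), (rng f); split.
  rewrite -cats1; apply/is_path_cat; exists u; last by rewrite /= fh hu.
  by apply/is_path_cat; exists v.
(* The entries at position [size s] are [f] on one side and, on the other, an
   entry of [s], all of whose edges lie on the cycle. *)
move=> d d0 dN _; apply/prefixP => -[r] /(congr1 (fun l => nth f l (size s))).
rewrite [RHS]nth_cat size_rcons ltnS leqnn [RHS]nth_rcons ltnn eqxx.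
rewrite nth_cat ltnNge (leq_trans dN sN) /= nth_rcons.
have d_gt0 : (0 < size d)%N by case: (d) d0.
have lt_s : (size s - size d < size s)%N by lia.
rewrite lt_s => fE; have fs : f \in s by rewrite -{1}fE mem_nth.
by rewrite sg in fg.
Qed.

End Exits.

Section Reduction.
Variables (K : fieldType) (E : graph).
Local Notation L := (leavitt K E).
Local Notation pth := (pth K).
Local Notation gst := (gst K).
Local Notation vtx := (vtx K).
Hypothesis Erow : row_finite E.

Lemma out_edges (v : vertex E) :
  exists s : seq (edge E), uniq s /\ forall e, e \in s <-> src e = v.
Proof.
have /finite_seqP[s sE] := Erow v.
exists (undup s); split=> [|e]; first exact: undup_uniq.
rewrite mem_undup; have := congr1 (fun A => A e) sE.
by rewrite /= => ->.
Qed.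

Lemma vtx_supportP (x : L) : exists s0 : seq (vertex E), forall s,
  uniq s -> {subset s0 <= s} -> \sum_(u <- s) x ** vtx u = x.
Proof.
elim/leavitt_ind: x => [|x y [s1 Hx] [s2 Hy]|k x [s1 Hx]|v v' p q w vp vq].
- by exists [::] => s _ _; rewrite big1 // => u _; rewrite r0mul.
- exists (s1 ++ s2) => s us ss.
  under eq_bigr => u _ do rewrite rng_mulDl.
  by rewrite big_split Hx ?Hy // => u us'; apply: ss; rewrite mem_cat us' ?orbT.
- exists s1 => s us ss; under eq_bigr => u _ do rewrite -rng_scalerAl.
  by rewrite -scaler_sumr Hx.
- exists [:: v'] => s us ss.
  have v's : v' \in s by apply: ss; rewrite inE.
  have mv : pth p w ** gst q w ** vtx v' = pth p w ** gst q w.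
    by rewrite -rng_mulA gst_vtx /is_pathb asboolT.
  rewrite (bigD1_seq v') //= mv big1 ?addr0 // => u uv'.
  by rewrite -mv -rng_mulA vtxM eq_sym (negPf uv') rmul0.
Qed.

Lemma mul_vtx_neq0 (x : L) : x <> 0 -> exists w, x ** vtx w <> 0.
Proof.
move=> x0; apply: contrapT => nw; apply: x0.
have [s0 H] := vtx_supportP x.
rewrite -(H (undup s0)) ?undup_uniq //; last by move=> u; rewrite mem_undup.
by rewrite big1 // => u _; apply: contrapT => xu; apply: nw; exists u.
Qed.

(** The length of the ghosts is the quantity that the elimination of ghosts makes
    decrease; their common source [w] tells which edges to multiply by. *)
Inductive ghost_le (n : nat) (w : vertex E) : L -> Prop :=
  | Ghost0 : ghost_le n w 0
  | GhostD x y : ghost_le n w x -> ghost_le n w y -> ghost_le n w (x + y)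
  | GhostZ k x : ghost_le n w x -> ghost_le n w (k *: x)
  | GhostM p q u : is_path w q u -> (size q <= n)%N ->
      ghost_le n w (pth p u ** gst q u).

Lemma ghost_le_mono m n w x : (m <= n)%N -> ghost_le m w x -> ghost_le n w x.
Proof.
move=> mn; elim=> *; [exact: Ghost0|exact: GhostD|exact: GhostZ|].
by apply: GhostM => //; apply: leq_trans mn.
Qed.

Lemma ghost_le_vtx n w x : ghost_le n w x -> x ** vtx w = x.
Proof.
elim=> [|y z _ IHy _ IHz|k y _ IH|p q u wq _].
- by rewrite r0mul.
- by rewrite rng_mulDl IHy IHz.
- by rewrite -rng_scalerAl IH.
- by rewrite -rng_mulA gst_vtx /is_pathb asboolT.
Qed.

Lemma ghost_le_edge n e x : ghost_le n.+1 (src e) x -> ghost_le n (rng e) (x ** edg K e).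
Proof.
elim=> [|y z _ IHy _ IHz|k y _ IH|p q u wq sq].
- by rewrite r0mul; exact: Ghost0.
- by rewrite rng_mulDl; exact: GhostD.
- by rewrite -rng_scalerAl; exact: GhostZ.
case: q wq sq => [<- _|f q [fe uq] sq].
  have -> : pth p (src e) ** gst [::] (src e) ** edg K e
      = pth (p ++ [:: e]) (rng e) ** gst [::] (rng e).
    rewrite /= !pth_vtx !eqxx.
    have -> : edg K e = pth [:: e] (rng e) by rewrite /= edg_vtx eqxx.
    by apply: pth_cat.
  exact: GhostM.
rewrite gst_cons -!rng_mulA gho_edg; case: eqP => [ef|_].
  by rewrite gst_vtx /is_pathb asboolT -?ef //; apply: GhostM.
by rewrite !rmul0; exact: Ghost0.
Qed.

Lemma ghost_le_sink n w x : (forall e, src e <> w) -> ghost_le n w x -> ghost_le 0 w x.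
Proof.
move=> sw; elim=> [|y z _ ? _ ?|k y _ ?|p q u wq _].
- exact: Ghost0.
- exact: GhostD.
- exact: GhostZ.
- by apply: GhostM => //; case: q wq => // e q [/sw].
Qed.

Lemma ghost_le_ex (x : L) w : exists n, ghost_le n w (x ** vtx w).
Proof.
elim/leavitt_ind: x => [|x y [m Hx] [n Hy]|k x [n Hx]|v v' p q u vp vq].
- by exists 0%N; rewrite r0mul; exact: Ghost0.
- exists (maxn m n); rewrite rng_mulDl; apply: GhostD.
    exact: ghost_le_mono (leq_maxl _ _) Hx.
  exact: ghost_le_mono (leq_maxr _ _) Hy.
- by exists n; rewrite -rng_scalerAl; exact: GhostZ.
- exists (size q); rewrite -rng_mulA gst_vtx.
  by case: ifPn => [/asboolP wq|_]; rewrite ?rmul0; [exact: GhostM|exact: Ghost0].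
Qed.

(** If [w] emits edges, then [x] is the sum of the [x e e^*], hence some [x e] is
    nonzero, and its ghosts are shorter unless they were already trivial. *)
Lemma ghost_elim n w x : ghost_le n w x -> x <> 0 ->
  exists b w', x ** b <> 0 /\ ghost_le 0 w' (x ** b).
Proof.
elim: n w x => [|n IH] w x gx x0; first by exists (vtx w), w; rewrite (ghost_le_vtx gx).
have [s [us sE]] := out_edges w.
case: s us sE => [_ sE|f s us sE].
  exists (vtx w), w; rewrite (ghost_le_vtx gx); split=> //.
  by apply: ghost_le_sink gx => e /sE.
have [[e [ew xe0]]|ne] := pselect (exists e, src e = w /\ x ** edg K e <> 0).
  rewrite -ew in gx; have [b [w' [xb gb]]] := IH _ _ (ghost_le_edge gx) xe0.
  by exists (edg K e ** b), w'; rewrite rng_mulA.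
case: x0; rewrite -(ghost_le_vtx gx) (cuntz_krieger K _ us sE) // rmul_sumr.
rewrite big_seq big1 // => e /sE ew; rewrite rng_mulA.
have -> : x ** edg K e = 0; last by rewrite r0mul.
by apply: contrapT => xe; apply: ne; exists e.
Qed.

Lemma sum_subseq_coef (s s1 : seq (seq (edge E))) (c : seq (edge E) -> K)
    (F : seq (edge E) -> L) : uniq s -> uniq s1 -> {subset s1 <= s} ->
  \sum_(p <- s) (if p \in s1 then c p else 0) *: F p = \sum_(p <- s1) c p *: F p.
Proof.
move=> us us1 ss.
transitivity (\sum_(p <- s | p \in s1) c p *: F p).
  rewrite [RHS]big_mkcond; apply: eq_bigr => p _; case: ifP => // _.
  by rewrite scale0r.
rewrite -big_filter; apply: perm_big; apply: uniq_perm => //; first exact: filter_uniq.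
by move=> p; rewrite mem_filter; case: (boolP (p \in s1)) => // /ss.
Qed.

(** Coefficients are collected so that the paths are pairwise distinct: the
    reduction singles out one path and needs its total coefficient. *)
Lemma real_form w x : ghost_le 0 w x ->
  exists s (c : seq (edge E) -> K), uniq s /\ x = \sum_(p <- s) c p *: pth p w.
Proof.
elim=> [|y z _ [s1 [c1 [us1 ->]]] _ [s2 [c2 [us2 ->]]]|k y _ [s [c [us ->]]]|p q u wq q0].
- by exists [::], (fun=> 0); rewrite big_nil.
- exists (undup (s1 ++ s2)),
    (fun p => (if p \in s1 then c1 p else 0) + (if p \in s2 then c2 p else 0)).
  split; first exact: undup_uniq.
  under [RHS]eq_bigr => p _ do rewrite scalerDl.
  rewrite big_split /= !sum_subseq_coef ?undup_uniq // => p ps;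
    by rewrite mem_undup mem_cat ps ?orbT.
- exists s, (fun p => k * c p); split=> //.
  by rewrite scaler_sumr; apply: eq_bigr => p _; rewrite scalerA.
- case: q wq q0 => // <- _; exists [:: p], (fun=> 1); split=> //.
  by rewrite big_seq1 scale1r /= pth_vtx eqxx.
Qed.

Lemma gst_pth_cat (v w : vertex E) p q :
  is_path v p w -> gst p w ** pth (p ++ q) w = vtx w ** pth q w.
Proof.
elim: p v => [|e p IH] v //= [_ pw].
rewrite rng_mulA -(rng_mulA (gst p w)) gho_edg eqxx gst_vtx /is_pathb asboolT //.
exact: IH pw.
Qed.

(** After ghosts are removed, let [p1] be of minimal length among the paths that
    occur.  Another path [p] either does not extend [p1], and is killed by the
    ghost of [p1], or is [p1] followed by a closed path, which is killed by the
    compression by an escaping path [t]. *)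
Theorem reduction (x : L) : condition_L E -> x <> 0 ->
  exists a b k v, k <> 0 /\ a ** x ** b = k *: vtx v.
Proof.
move=> EL x0; have [w0 xw0] := mul_vtx_neq0 x0.
have [n gn] := ghost_le_ex x w0.
have [b [w [y0 gy]]] := ghost_elim gn xw0.
set y := x ** vtx w0 ** b in y0 gy *.
have [s [c [us yE]]] := real_form gy.
pose P p := [&& p \in s, c p != 0 & `[< exists v, is_path v p w >]].
have [p0 Pp0] : exists p, P p.
  apply: contrapT => nP; apply: y0; rewrite yE big_seq big1 // => p ps.
  have [->|cp] := eqVneq (c p) 0; first by rewrite scale0r.
  have [[v vp]|np] := pselect (exists v, is_path v p w).
    by case: nP; exists p; rewrite /P ps cp; apply/asboolP; exists v.
  by rewrite pth_eq0 ?scaler0 // => v vp; apply: np; exists v.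
(* [P] selects the paths that contribute to [y]; [p1] is a shortest one. *)
pose Q m := has (fun p => P p && (size p == m)) s.
have exQ : exists m, Q m.
  by exists (size p0); apply/hasP; exists p0; rewrite ?Pp0 ?eqxx //; case/and3P: Pp0.
case: (ex_minnP exQ) => m /hasP[p1 p1s /andP[Pp1 /eqP sp1]] minm.
have minp p : P p -> (size p1 <= size p)%N.
  move=> Pp; rewrite sp1; apply: minm; apply/hasP; exists p; last by rewrite Pp eqxx.
  by case/and3P: Pp.
have /and3P[_ cp1 /asboolP[v vp1]] := Pp1.
have [t [u [wt esc]]] := escaping_path w (\max_(p <- s) size p) EL.
exists (gst t u ** gst p1 w), (vtx w0 ** b ** pth t u), (c p1), u.
split; first exact/eqP.
have -> : gst t u ** gst p1 w ** x ** (vtx w0 ** b ** pth t u)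
    = gst t u ** gst p1 w ** y ** pth t u by rewrite /y !rng_mulA.
rewrite yE rmul_sumr rmul_suml (bigD1_seq p1) //=.
rewrite -rng_scalerAr -rng_scalerAl -(rng_mulA (gst t u)) (gst_pth K vp1).
rewrite gst_vtx /is_pathb asboolT // (gst_pth K wt) big_seq_cond big1 ?addr0 //.
move=> p /andP[ps pp1]; rewrite -rng_scalerAr -rng_scalerAl.
have [->|cp] := eqVneq (c p) 0; first by rewrite scale0r.
have [vp|np] := pselect (exists v, is_path v p w); last first.
  by rewrite pth_eq0 ?rmul0 ?r0mul ?scaler0 // => u' up; apply: np; exists u'.
have sp1p : (size p1 <= size p)%N by apply: minp; rewrite /P ps cp; apply/asboolP.
rewrite -(rng_mulA (gst t u)).
have [/prefixP[d pE]|npre] := boolP (prefix p1 p); last first.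
  by rewrite gst_pth0 // rmul0 r0mul scaler0.
rewrite pE (gst_pth_cat _ vp1) vtx_pth; case: ifPn => [/asboolP wd|_]; last first.
  by rewrite rmul0 r0mul scaler0.
rewrite -rng_mulA (pth_cat K _ wt) gst_pth0 ?scaler0 //.
  by rewrite size_cat leq_addl.
apply: esc => //; first by move=> d0; move: pp1; rewrite pE d0 cats0 eqxx.
apply: (@leq_trans (size p)); first by rewrite pE size_cat leq_addl.
exact: leq_bigmax_seq.
Qed.

Lemma ideal_has_vertex (I : set L) : condition_L E -> two_sided_ideal I ->
  I <> [set 0]%classic -> exists v, I (vtx v).
Proof.
move=> EL idI /(ideal_nonzero idI)[x Ix x0].
have [a [b [k [v [k0 axb]]]]] := reduction EL x0.
exists v; have -> : vtx v = (k^-1 *: a) ** x ** b.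
  by rewrite -!rng_scalerAl axb scalerA mulVf ?scale1r //; apply/eqP.
by apply: ideal_mulr => //; apply: ideal_mull.
Qed.

Lemma ideal_reaches (I : set L) v w : two_sided_ideal I -> reaches v w ->
  I (vtx v) -> I (vtx w).
Proof.
move=> idI [p vp] Iv; rewrite -(gst_pth K vp).
have <- : vtx v ** pth p w = pth p w by rewrite vtx_pth /is_pathb asboolT.
by apply: ideal_mull => //; apply: ideal_mulr.
Qed.

Lemma L_MT3_ideals : condition_L E /\ condition_MT3 E -> ideals_meet K E.
Proof.
move=> [EL EM] I J idI idJ I0 J0.
have [v Iv] := ideal_has_vertex EL idI I0.
have [w Jw] := ideal_has_vertex EL idJ J0.
have [y [vy wy]] := EM v w.
by exists y; split; [apply: ideal_reaches vy Iv|apply: ideal_reaches wy Jw].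
Qed.

End Reduction.

(** * Condition (MT3) from intersecting ideals *)

Section IdealsMeet.
Variables (K : fieldType) (E : graph).
Local Notation L := (leavitt K E).
Local Notation vtx := (vtx K).

Lemma ideal_with_vertex (I : set L) v : I (vtx v) -> I <> [set 0]%classic.
Proof. by move=> Iv I0; apply: (@vtx_neq0 K E v); rewrite I0 in Iv. Qed.

(** If [v] and [w] have no common descendant then [v L w = 0], and the left
    annihilator [I] of [L w] and the right annihilator [J] of [I] are ideals that
    contain [v] and [w].  A common vertex [y] would satisfy [y = y y = 0]. *)
Lemma ideals_meet_MT3 : ideals_meet K E -> condition_MT3 E.
Proof.
move=> meet v w; apply: contrapT => noy.
have vLw x : vtx v ** x ** vtx w = 0.
  by apply: contrapT => h; apply: noy; exact: corner_reaches h.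
pose I : set L := [set x : L | forall r : L, x ** r ** vtx w = 0].
pose J : set L := [set x : L | forall i : L, I i -> i ** x = 0].
have idI : two_sided_ideal I.
  split=> [|r x Ix]; first split=> [r|x y Ix Iy r]; first by rewrite !r0mul.
    by rewrite rng_mulDl rNmul rng_mulDl rNmul Ix Iy subrr.
  by split=> s; [rewrite -!rng_mulA (rng_mulA x) Ix rmul0|rewrite -(rng_mulA x)].
have idJ : two_sided_ideal J.
  split=> [|r x Jx]; first split=> [i|x y Jx Jy i Ii]; first by rewrite rmul0.
    by rewrite rng_mulDr rmulN Jx // Jy // subrr.
  split=> i Ii; last by rewrite rng_mulA Jx // r0mul.
  by rewrite rng_mulA Jx //; exact: (ideal_mulr r idI).
have Iv : I (vtx v) by move=> r.
have Jw : J (vtx w) by move=> i Ii; have := Ii (vtx w); rewrite -rng_mulA vtxM eqxx.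
have [y [Iy Jy]] := meet I J idI idJ (ideal_with_vertex Iv) (ideal_with_vertex Jw).
by apply: (@vtx_neq0 K E y); have := Jy _ Iy; rewrite vtxM eqxx.
Qed.

End IdealsMeet.

(** * A boundary path reached from every vertex *)

Section Cofinal.
Variable E : graph.
Local Notation ext := (edge E + vertex E)%type.

Fixpoint is_xpath (v : vertex E) (p : seq ext) (w : vertex E) : Prop :=
  if p is a :: q then [/\ xok a, xsrc a = v & is_xpath (xrng a) q w] else v = w.

Lemma is_xpath_cat u v w p q : is_xpath u p v -> is_xpath v q w -> is_xpath u (p ++ q) w.
Proof. by elim: p u => [|a p IH] u /= => [->//|[oka au pv] qw]; split=> //; apply: IH. Qed.

Lemma is_xpath_inl v p w : is_path v p w -> is_xpath v (map inl p) w.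
Proof. by elim: p v => //= e p IH v [ev pw]; split=> //; apply: IH. Qed.

Lemma is_xpath_nth v p w a0 i : is_xpath v p w -> (i.+1 < size p)%N ->
  xok (nth a0 p i) /\ xrng (nth a0 p i) = xsrc (nth a0 p i.+1).
Proof.
elim: p v i => //= a p IH v [|i] [oka av pw] ip; last exact: IH pw ip.
by case: p pw ip {IH} => //= b p [_ <- _].
Qed.

(** The extra step after the common descendant ensures that pieces are nonempty,
    so that putting them one after another yields an infinite sequence; at a sink
    that step is the added loop. *)
Lemma cofinal_step : condition_MT3 E -> forall y v : vertex E,
  exists pz : seq ext * vertex E,
    [/\ pz.1 <> [::], is_xpath y pz.1 pz.2 & reaches v pz.2].
Proof.
move=> EM y v; have [z [[p yz] vz]] := EM y v.
have nz : reaches z (xrng (chosen_step z)).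
  have := xsrc_chosen_step z; case: (chosen_step z) => [e|w] /= <-; last exact: reachesxx.
  by exists [:: e].
exists (map inl p ++ [:: chosen_step z], xrng (chosen_step z)); split=> /=.
- by case: p {yz}.
- apply: is_xpath_cat (is_xpath_inl yz) _.
  by split=> //; [exact: xok_chosen_step|exact: xsrc_chosen_step].
- exact: reaches_trans vz nz.
Qed.

(** The [n]-th piece leads to a descendant of the [n]-th vertex. *)
Lemma cofinal_path (v0 : vertex E) : condition_MT3 E ->
  exists lam : bpath E, forall v, exists m, reaches v (bbase (bshift m lam)).
Proof.
move=> EM.
have [P HP] := choice (fun yv => cofinal_step EM yv.1 yv.2).
(* Numbers that encode no vertex are given the target [v0]. *)
pose target n := odflt v0 (unpickle n).
pose fix st n : seq ext * vertex E :=
  if n is m.+1 then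
    ((st m).1 ++ (P ((st m).2, target m)).1, (P ((st m).2, target m)).2)
  else ([::], v0).
have stS n : st n.+1 = ((st n).1 ++ (P ((st n).2, target n)).1, (P ((st n).2, target n)).2) by [].
have st_path n : is_xpath v0 (st n).1 (st n).2.
  elim: n => // n IH; rewrite stS; apply: is_xpath_cat IH _.
  by have [] := HP ((st n).2, target n).
have Pgt0 yv : (0 < size (P yv).1)%N.
  by have [+ _ _] := HP yv; case: (P yv).1.
have size_st n : (n <= size (st n).1)%N.
  elim: n => // n IH; rewrite stS size_cat -addn1; apply: leq_add => //.
have nth_st a0 n k i : (i < size (st n).1)%N -> nth a0 (st (n + k)%N).1 i = nth a0 (st n).1 i.
  move=> isz; have sz_mono j : (size (st n).1 <= size (st (n + j)%N).1)%N.
    elim: j => [|j IH]; first by rewrite addn0.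
    by rewrite addnS stS size_cat; apply: leq_trans IH (leq_addr _ _).
  elim: k => [|k IH]; first by rewrite addn0.
  by rewrite addnS stS nth_cat (leq_trans isz (sz_mono k)).
pose a0 : ext := inr v0.
pose lam i := nth a0 (st i.+1).1 i.
have lamE n i : (i < size (st n).1)%N -> lam i = nth a0 (st n).1 i.
  move=> isz; rewrite /lam; have [le|/ltnW le] := leqP n i.+1.
    by rewrite -(subnKC le) nth_st.
  by rewrite -(subnKC le) nth_st //; exact: size_st.
have blam : boundary lam.
  move=> i; rewrite (lamE i.+2) ?(lamE i.+2 i.+1).
  - exact: is_xpath_nth (st_path _) (size_st _).
  - exact: size_st.
  - exact: leq_trans (leqnSn _) (size_st _).
have base_st n : bbase (bshift (size (st n).1) (exist _ lam blam)) = (st n).2.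
  rewrite /bbase /= /shift addn0.
  rewrite (lamE n.+1); last by rewrite stS size_cat -[X in (X < _)%N]addn0 ltn_add2l.
  rewrite stS nth_cat ltnn subnn.
  have [+ + _] := HP ((st n).2, target n).
  by case: (P _).1 => //= a p _ [].
exists (exist _ lam blam) => v; exists (size (st (pickle v).+1).1); rewrite base_st.
rewrite stS; have [_ _] := HP ((st (pickle v)).2, target (pickle v)).
by rewrite /target pickleK.
Qed.

End Cofinal.

(** * The simple module of a tail class *)

Section TailClass.
Variables (K : fieldType) (E : graph).
Local Notation L := (leavitt K E).
Local Notation vtx := (vtx K).
Local Notation BS := (boundary_system E).
Local Notation F := (bpath E -> K^o).
Implicit Types (x y eta : bpath E) (f g : F).
Local Notation act := (@bact K E BS).
Let actM := @bact_module K E BS.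

Definition delta x : F := fun y => if `[< y = x >] then 1 else 0.

Lemma bshiftD m n x : bshift n (bshift m x) = bshift (m + n)%N x.
Proof. by apply: bpath_ext => i; rewrite /= /shift addnA. Qed.

Lemma bshift0 x : bshift 0 x = x. Proof. exact: bpath_ext. Qed.

Lemma btail_bshift n x : btail (bshift n x) = bshift n.+1 x.
Proof. by rewrite /btail bshiftD addn1. Qed.

Lemma sink_head x w : sink w -> bbase x = w -> sval x 0%N = inr w.
Proof. by rewrite /bbase; case: (sval x 0%N) => [e sw /sw//|u _ /= ->]. Qed.

Lemma sink_tail x w : sval x 0%N = inr w -> btail x = x.
Proof.
move=> x0; have sw : sink w by have [] := svalP x 0%N; rewrite x0.
have xw n : sval x n = inr w.
  elim: n => // n IH; have [_] := svalP x n; rewrite IH /=.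
  by case: (sval x n.+1) => [e /esym/sw//|u /= ->].
by apply: bpath_ext => n; rewrite /= /shift !xw.
Qed.

Lemma btail_bcons e x : bbase x = rng e -> btail (bcons e x) = x.
Proof. exact: (@tail_pcons _ BS). Qed.

Lemma bhead_inl x e : sval x 0%N = inl e -> bhead x = Some e.
Proof. by rewrite /bhead => ->. Qed.

Lemma bcons_btail x e : sval x 0%N = inl e -> bcons e (btail x) = x.
Proof. by move=> x0; apply: (@pcons_tail _ BS); rewrite /= (bhead_inl x0). Qed.

(** The elements of the module spanned by the tail class of [lam] are functions
    of finite support in this class.  Discreteness of the support, in the form
    that prefixes of a given boundary path [eta] isolate it from the other points
    of the support, is enough to prove simplicity, and it is stable under the
    algebra without any bookkeeping of supports. *)
Definition agree n x y := forall i, (i < n)%N -> sval x i = sval y i.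
Definition isolated f :=
  forall eta, exists N, forall x, f x <> 0 -> agree N x eta -> x = eta.
Definition tail_eq x y := exists n m, bshift n x = bshift m y.
Definition tail_discrete lam f := isolated f /\ forall x, f x <> 0 -> tail_eq x lam.

Lemma tail_discrete_sub lam f g :
  (forall x, g x <> 0 -> f x <> 0) -> tail_discrete lam f -> tail_discrete lam g.
Proof.
move=> gf [fi ft]; split=> [eta|x /gf]; last exact: ft.
by have [N H] := fi eta; exists N => x /gf; exact: H.
Qed.

Lemma tail_discreteD lam f g :
  tail_discrete lam f -> tail_discrete lam g -> tail_discrete lam (f + g).
Proof.
move=> [fi ft] [gi gt].
have fg x : (f + g) x <> 0 -> f x <> 0 \/ g x <> 0.
  move=> fgx; have [f0|f0] := pselect (f x = 0); last by left.
  by right => g0; apply: fgx; rewrite /= fctE f0 g0 addr0.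
split=> [eta|x /fg[]]; [|exact: ft|exact: gt].
have [M HM] := fi eta; have [N HN] := gi eta.
exists (maxn M N) => x /fg[] h ag; [apply: HM|apply: HN] => // i iN; apply: ag.
  by rewrite leq_max iN.
by rewrite leq_max iN orbT.
Qed.

Lemma tail_discrete_ev lam (t : lterm K E) f :
  tail_discrete lam f -> tail_discrete lam (ev (B := BS) t f).
Proof.
elim: t f => [v|e|e||a IHa b IHb|a IHa|k a IHa|a IHa b IHb] f nf /=.
- by apply: tail_discrete_sub nf => x; case: ifP.
- case: nf => fi ft; split=> [eta|x].
    have [N H] := fi (btail eta); exists N.+1 => x.
    case: eqP => // hx fx ag.
    have tx : btail x = btail eta by apply: H => // i iN; rewrite /= /shift !add1n; apply: ag.
    apply: bpath_ext => -[|n]; first exact: ag.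
    by have := congr1 (fun y => sval y n) tx; rewrite /= /shift !add1n.
  case: eqP => // _ /ft[n [m nm]].
  by exists n.+1, m; rewrite -nm -[n.+1]add1n -bshiftD.
- case: nf => fi ft; split=> [eta|x].
    have [be|be] := eqVneq (bbase eta) (rng e); last first.
      exists 1%N => x; case: eqP => // bx _ ag.
      by case/eqP: be; rewrite -bx /= /bbase ag.
    have [N H] := fi (bcons e eta); exists N => x; case: eqP => // bx fx ag.
    rewrite -(btail_bcons bx) -(btail_bcons be); congr btail; apply: H => // i iN.
    rewrite !bconsE //; case: i iN => //= i iN; apply: ag; exact: ltnW.
  case: eqP => // bx /ft[n [m nm]]; exists n, m.+1.
  rewrite -btail_bshift -nm btail_bshift -[n.+1]add1n -bshiftD; congr bshift.
  exact/esym/(btail_bcons bx).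
- by split=> [eta|x]; [exists 0%N|].
- by apply: tail_discreteD; [exact: IHa|exact: IHb].
- by apply: tail_discrete_sub (IHa _ nf) => x nx fx; apply: nx; rewrite !fctE fx oppr0.
- by apply: tail_discrete_sub (IHa _ nf) => x nx fx; apply: nx; rewrite !fctE fx scaler0.
- exact: IHa (IHb _ nf).
Qed.

Lemma tail_discrete_delta lam : tail_discrete lam (delta lam).
Proof.
split=> [eta|x].
  have [->|ne] := pselect (eta = lam).
    by exists 0%N => x; rewrite /delta; case: asboolP.
  have [n nn] : exists n, sval lam n <> sval eta n.
    apply: contrapT => nn; apply: ne; apply: bpath_ext => n.
    by apply: contrapT => h; apply: nn; exists n => /esym.
  exists n.+1 => x; rewrite /delta; case: asboolP => // -> _ ag.
  by case: nn; apply: ag.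
by rewrite /delta; case: asboolP => // -> _; exists 0%N, 0%N.
Qed.

(** [r] is the ghost of the prefix of length [n] of [eta]. *)
Lemma cut_prefix eta n : exists r : L, forall f,
  act r f (bshift n eta) = f eta /\
  forall x, act r f x <> 0 -> exists x', [/\ f x' <> 0, agree n x' eta & bshift n x' = x].
Proof.
elim: n => [|n [r Hr]].
  exists (vtx (bbase eta)) => f; rewrite bact_vtx bshift0 /= eqxx; split=> // x.
  by case: ifP => // _ fx; exists x; rewrite bshift0; split=> // i.
have agS x : agree n x eta -> sval x n = sval eta n -> agree n.+1 x eta.
  by move=> ag xn i; rewrite ltnS leq_eqVlt => /orP[/eqP->|/ag].
have s0 x : sval (bshift n x) 0%N = sval x n by rewrite /= /shift addn0.
case en : (sval eta n) => [e|w].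
  have e0 : sval (bshift n eta) 0%N = inl e by rewrite s0.
  exists (gho K e ** r) => f; have [Hv Hs] := Hr f; rewrite (actA actM) bact_gho.
  split=> [|x].
    have be : bbase (btail (bshift n eta)) = rng e.
      exact: (@base_tail _ BS _ _ (bhead_inl e0)).
    by rewrite -btail_bshift /= be eqxx (bcons_btail e0).
  case: eqP => // bx /Hs[x' [fx' ag xx']]; exists x'; split=> //.
    by apply: agS => //; rewrite -s0 xx' en bconsE.
  by rewrite -btail_bshift xx' btail_bcons.
have e0 : sval (bshift n eta) 0%N = inr w by rewrite s0.
have sw : sink w by have [] := svalP eta n; rewrite en.
exists (vtx w ** r) => f; have [Hv Hs] := Hr f; rewrite (actA actM) bact_vtx.
split=> [|x].
  by rewrite -btail_bshift (sink_tail e0) /= /bbase e0 eqxx.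
case: eqP => // bx /Hs[x' [fx' ag xx']]; exists x'.
have x0 := sink_head sw bx.
split=> //; first by apply: agS => //; rewrite -s0 xx' en x0.
by rewrite -btail_bshift xx' (sink_tail x0).
Qed.

(** [r] is the prefix of length [n] of [eta]. *)
Lemma glue_prefix eta n : exists r : L, act r (delta (bshift n eta)) = delta eta.
Proof.
elim: n => [|n [r Hr]].
  exists (vtx (bbase eta)); rewrite bact_vtx bshift0; apply/funext => x.
  by rewrite /delta; case: asboolP => [->|_]; rewrite /= ?eqxx //; case: ifP.
suff [s Hs] : exists s : L, act s (delta (bshift n.+1 eta)) = delta (bshift n eta).
  by exists (r ** s); rewrite (actA actM) Hs.
rewrite -btail_bshift; move: (bshift n eta) => y {r Hr}.
case y0 : (sval y 0%N) => [e|w].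
  exists (edg K e); rewrite bact_edg; apply/funext => x; rewrite /delta /=.
  case: eqP => [hx|hx].
    have -> : `[< btail x = btail y >] = `[< x = y >] => //.
    apply/asbool_equiv_eq; split=> [xy|->//].
    by rewrite -(bcons_btail y0) -xy; exact/esym/(@pcons_tail _ BS _ _ hx).
  by case: asboolP => // xy; case: hx; rewrite xy (bhead_inl y0).
exists (vtx w); rewrite (sink_tail y0) bact_vtx; apply/funext => x.
rewrite /delta; case: asboolP => [->|_]; last by case: ifP.
by rewrite /= /bbase y0 eqxx.
Qed.

(** Cutting a long enough prefix of a point [eta] of the support kills all other
    points, and leaves a multiple of a common tail of [eta] and [lam], to which a
    prefix of [lam] is glued. *)
Lemma tail_class_simple lam (r : L) : act r (delta lam) <> 0 ->
  exists s, act s (act r (delta lam)) = delta lam.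
Proof.
set f := act r (delta lam) => f0.
have [fi ft] : tail_discrete lam f by exact: tail_discrete_ev (tail_discrete_delta lam).
have [eta fe] : exists eta, f eta <> 0.
  apply: contrapT => nf; apply: f0; apply/funext => x.
  by apply: contrapT => fx; apply: nf; exists x.
have [N HN] := fi eta; have [n0 [m0 nm]] := ft _ fe.
(* Beyond [N] the point [eta] is alone; beyond [n0] its tail is one of [lam]. *)
pose n := maxn N n0.
have [y /(_ f)[yv ys]] := cut_prefix eta n.
have yf : act y f = f eta *: delta (bshift n eta).
  apply/funext => x; rewrite !fctE /delta; case: asboolP => [->|xn].
    by rewrite yv /GRing.scale /= mulr1.
  rewrite scaler0; apply: contrapT => /ys[x' [fx' ag xx']]; apply: xn.
  rewrite -xx' (HN _ fx') // => i iN; apply: ag; apply: leq_trans iN _.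
  exact: leq_maxl.
have [z zl] := glue_prefix lam (m0 + (n - n0))%N.
exists (((f eta)^-1 : K) *: (z ** y)).
rewrite bact_scale (actA actM) yf bactZ.
have -> : bshift n eta = bshift (m0 + (n - n0)) lam.
  by rewrite -bshiftD -nm bshiftD subnKC // leq_maxr.
by rewrite zl scalerA mulVf ?scale1r //; apply/eqP.
Qed.

Lemma delta_neq0 lam : delta lam <> 0.
Proof.
move=> /(congr1 (fun f => f lam)); rewrite /delta asboolT //= => /eqP.
by rewrite oner_eq0.
Qed.

Lemma tail_class_faithful lam : ideals_meet K E ->
  (forall v, exists m, reaches v (bbase (bshift m lam))) ->
  forall r : L, (forall s, act r (act s (delta lam)) = 0) -> r = 0.
Proof.
move=> meet cof r rA; apply: contrapT => r0.
pose A : set L := [set r : L | forall s : L, act r (act s (delta lam)) = 0].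
have idA : two_sided_ideal A.
  split=> [|s x Ax]; first split=> [s|x y Ax Ay s].
  - by rewrite (act0l actM).
  - by rewrite (actDl actM) (actNl actM) Ax Ay subrr.
  - split=> t; first by rewrite (actA actM) Ax (act0r actM).
    by rewrite (actA actM) -(actA actM s t) Ax.
have A0 : A <> [set 0]%classic.
  by move=> A0; have : A r by []; rewrite A0.
have [v [Av _]] := meet A A idA idA A0 A0.
have [m [p vp]] := cof v; set w := bbase _ in vp.
have [y /(_ (delta lam))[yv _]] := cut_prefix lam m.
have := Av (pth K p w ** y); rewrite !(actA actM) -(actA actM (vtx v)).
rewrite vtx_pth /is_pathb asboolT // => /(congr1 (act (gst K p w))).
rewrite (act0r actM) -(actA actM) (gst_pth K vp) bact_vtx.
move=> /(congr1 (fun f => f (bshift m lam))); rewrite /= eqxx yv /delta asboolT //.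
by move=> /eqP; rewrite oner_eq0.
Qed.

(** Without vertices the algebra is [0], and any abelian group of prime order is
    a faithful simple module. *)
Lemma empty_primitive : (vertex E -> False) -> left_primitive L.
Proof.
move=> noE; exists 'F_2, (fun _ _ => 0); split.
- by split=> *; rewrite ?addr0.
- split; first by exists 1 => /eqP; rewrite oner_eq0.
  move=> N [N0 NB] _; have [N1|N1] := pselect (N 1); [right|left].
    apply/seteqP; split=> // x _; have [->//|->//] : x = 0 \/ x = 1.
    by case: x => -[|[|]] // ?; [left|right]; apply: val_inj.
  apply/seteqP; split=> [x Nx|x ->//]; apply: contrapT => x0; apply: N1.
  suff <- : x = 1 by [].
  case: x x0 {Nx} => -[|[|]] // i x0; first by case: x0; apply: val_inj.
  exact: val_inj.
- move=> r _; elim/leavitt_ind: r => [//|x y -> ->|k x ->|v v' p q w _ _].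
  + by rewrite addr0.
  + by rewrite scaler0.
  + by case: (noE v).
Qed.

Lemma ideals_meet_primitive : ideals_meet K E -> left_primitive L.
Proof.
move=> meet; have [[v0 _]|nv] := pselect (exists v : vertex E, True); last first.
  by apply: empty_primitive => v; apply: nv; exists v.
have [lam cof] := cofinal_path v0 (ideals_meet_MT3 meet).
apply: (@primitive_of_orbit _ _ act (delta lam) actM).
- by have [r] := glue_prefix lam 0; rewrite bshift0; exists r.
- exact: delta_neq0.
- exact: tail_class_simple.
- exact: tail_class_faithful.
Qed.

End TailClass.

(** * The equivalence *)

Theorem theorem4p6 (K : fieldType) (E : graph) (Erow : row_finite E) :
  [<-> left_primitive (leavitt K E);
       right_primitive (leavitt K E);
       condition_L E /\ condition_MT3 E;
       forall I J : set (leavitt K E),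
         two_sided_ideal I -> two_sided_ideal J ->
         I <> [set 0%R]%classic -> J <> [set 0%R]%classic ->
         exists v : vertex E, I (leavitt_vertex K v) /\ J (leavitt_vertex K v)].
Proof.
tfae.
- exact: left_primitive_right.
- by move=> /right_primitive_left lp; split; [exact: primitive_L lp|exact: primitive_MT3 lp].
- exact: L_MT3_ideals.
- exact: ideals_meet_primitive.
Qed.
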